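(* Let $p$ be a prime, $n\ge2$, $X$ a nonempty totally ordered set and $S$ the free profinite group on the basis $X$. Let $u,v\in X^*$ be nonempty words with $i=|u|+|v|\in J(n)$. Then \[ \sum_{w\in X^i}(u\sqcup\!\sqcup\, v)_w\,\alpha_{w,n}=0 \quad\text{in } H^2(S/S_{(n,p)},\mathbb{Z}/p), \] where $X^i$ is the set of words of length $i$ and $(u\sqcup\!\sqcup\, v)_w$ is the coefficient of $w$ in $u\sqcup\!\sqcup\, v$.
   Context: Cohomology is continuous cohomology with coefficients $\mathbb{Z}/p$ (trivial action). For a profinite group $G$: $G^{(1)}=G$, $G^{(i+1)}=[G,G^{(i)}]$ (closed subgroups); $G_{(n,p)}$ is the closed subgroup generated by the $p^j$-th powers of elements of $G^{(i)}$ for all $ip^j\ge n$. $j_n(i)$ is the least integer $j\ge0$ with $ip^j\ge n$. $J(n)$ is the set of integers $1\le i\le n$ of the form $\lceil n/p^k\rceil$, $k\ge0$. Magnus map: for a profinite commutative ring $R$, $\Lambda_R:S\to R\langle\langle X\rangle\rangle^\times$ is the continuous homomorphism with $x\mapsto1+x$; $\Lambda_R(\sigma)=\sum_w\epsilon_{w,R}(\sigma)w$. $\alpha_{w,n}$ for $w=(x_1\cdots x_i)$ with $i\in J(n)$: $R_i=\mathbb{Z}/p^{j_n(i)+1}$; $\mathbb{U}=\mathbb{U}_i(R_i)$ the unipotent upper-triangular $(i+1)\times(i+1)$ matrices over $R_i$; $\mathbb{U}_{(n,p)}=I+p^{j_n(i)}\mathbb{Z}E_{1,i+1}$, central, identified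 with $\mathbb{Z}/p$ via the $(1,i+1)$-entry; $\overline{\mathbb{U}}=\mathbb{U}/\mathbb{U}_{(n,p)}$; $\gamma\in H^2(\overline{\mathbb{U}},\mathbb{Z}/p)$ the class of $0\to\mathbb{U}_{(n,p)}\to\mathbb{U}\to\overline{\mathbb{U}}\to1$; $\rho_w:S\to\mathbb{U}$, $\rho_w(\sigma)=(\epsilon_{(x_k\cdots x_{l-1}),R_i}(\sigma))_{1\le k\le l\le i+1}$ is a homomorphism inducing $\bar\rho_w:S/S_{(n,p)}\to\overline{\mathbb{U}}$; $\alpha_{w,n}=\bar\rho_w^*(\gamma)$. Shuffle product of $u=(x_1\cdots x_r)$, $v=(x_{r+1}\cdots x_{r+t})$: $u\sqcup\!\sqcup\, v=\sum_\sigma(x_{\sigma^{-1}(1)}\cdots x_{\sigma^{-1}(r+t)})\in\mathbb{Z}\langle X\rangle$, over permutations $\sigma$ of $\{1,\dots,r+t\}$ increasing on $\{1,\dots,r\}$ and on $\{r+1,\dots,r+t\}$. *)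

(* Defs.v *)
From HB Require Import structures.
From mathcomp Require Import all_boot all_order all_algebra all_fingroup.
From mathcomp Require Import all_classical.
From mathcomp Require Import generic_quotient ring_quotient topology ring.

Set Implicit Arguments.
Unset Strict Implicit.
Unset Printing Implicit Defensive.

Import Order.TTheory GRing.Theory.

Local Open Scope classical_set_scope.
Local Open Scope quotient_scope.
Local Open Scope ring_scope.

HB.mixin Record isTopologicalGroup G of monoid.Group G & Topological G := {
  mulg_continuous : continuous (fun xy : G * G => (xy.1 * xy.2)%g);
  invg_continuous : continuous (fun x : G => (x^-1)%g)
}.

#[short(type="topGroupType")]
HB.structure Definition TopologicalGroup :=
  {G of monoid.Group G & Topological G & isTopologicalGroup G}.

HB.mixin Record isProfinite G of Topological G := {
  profinite_compact : compact [set: G];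
  profinite_hausdorff : hausdorff_space G;
  profinite_totally_disconnected : totally_disconnected [set: G]
}.

#[short(type="profiniteGroupType")]
HB.structure Definition ProfiniteGroup :=
  {G of TopologicalGroup G & isProfinite G}.

Definition continuous_hom (G H : topGroupType) (f : G -> H) : Prop :=
  continuous f /\ {morph f : x y / (x * y)%g}.

Section Translations.
Variable G : topGroupType.

Lemma mulgr_continuous (z : G) : continuous (fun x => x * z)%g.
Proof.
move=> x; apply: (@continuous_comp _ _ _ (fun x => (x, z))
                    (fun xy => xy.1 * xy.2)%g); last exact: mulg_continuous.
by apply: cvg_pair => //; exact: cvg_cst.
Qed.

Lemma mulgl_continuous (z : G) : continuous (fun x => z * x)%g.
Proof.
move=> x; apply: (@continuous_comp _ _ _ (fun x => (z, x))
                    (fun xy => xy.1 * xy.2)%g); last exact: mulg_continuous.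
by apply: cvg_pair => //; exact: cvg_cst.
Qed.

Lemma conjg_continuous (z : G) : continuous (fun x => x ^ z)%g.
Proof.
move=> x; apply: (@continuous_comp _ _ _ (fun x => x * z)%g
                    (fun x => z^-1 * x)%g); first exact: mulgr_continuous.
exact: mulgl_continuous.
Qed.

End Translations.

Section Discrete.
Variable G : groupType.

HB.instance Definition _ := monoid.Group.copy (discrete_topology G) G.

Local Notation D := (discrete_topology G).

Lemma discrete_mulg_continuous :
  continuous (fun xy : D * D => (xy.1 * xy.2)%g : D).
Proof.
move=> [x y] A /= A_xy; exists ([set x], [set y]) => /=.
  by split; exact: discrete_set1.
by move=> [a b] [/= -> ->]; exact: nbhs_singleton A_xy.
Qed.

Lemma discrete_invg_continuous : continuous (fun x : D => (x^-1)%g : D).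
Proof.
move=> x A A_x; rewrite /= nbhs_principalE; apply/principal_filterP => /=.
exact: nbhs_singleton A_x.
Qed.

HB.instance Definition _ := isTopologicalGroup.Build D
  discrete_mulg_continuous discrete_invg_continuous.

End Discrete.

Definition is_subgroup (G : groupType) (H : set G) : Prop :=
  [/\ H 1%g, forall x y, H x -> H y -> H (x * y)%g & forall x, H x -> H x^-1%g].

Definition closed_subgroup (G : topGroupType) : set (set G) :=
  [set H | closed H /\ is_subgroup H].

Structure normal_subgroup (G : groupType) := NormalSubgroup {
  normal_set :> G -> Prop;
  normal_subgroupP : is_subgroup normal_set;
  normal_conj : forall x y, normal_set x -> normal_set (x ^ y)%g
}.

Section QuotientGroup.
Variables (G : topGroupType) (N : normal_subgroup G).

Definition coset_rel (x y : G) : bool := `[< N (x^-1 * y)%g >].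

Lemma coset_rel_refl : reflexive coset_rel.
Proof. by move=> x; apply/asboolP; rewrite mulVg; case: (normal_subgroupP N). Qed.

Lemma coset_rel_sym : symmetric coset_rel.
Proof.
have sub x y : coset_rel x y -> coset_rel y x.
  move=> /asboolP Nxy; apply/asboolP.
  have [_ _ NV] := normal_subgroupP N.
  by have := NV _ Nxy; rewrite invgM invgK.
by move=> x y; apply/idP/idP; exact: sub.
Qed.

Lemma coset_rel_trans : transitive coset_rel.
Proof.
move=> y x z /asboolP Nxy /asboolP Nyz; apply/asboolP.
have [_ NM _] := normal_subgroupP N.
by have := NM _ _ Nxy Nyz; rewrite mulgA mulgK.
Qed.

Canonical coset_equiv :=
  EquivRel coset_rel coset_rel_refl coset_rel_sym coset_rel_trans.

Definition quotient_group : Type := quotient_topology {eq_quot coset_rel}.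

HB.instance Definition _ := Topological.on quotient_group.
HB.instance Definition _ := Quotient.on quotient_group.

Local Notation Q := quotient_group.

Lemma eq_cosetP (x y : G) : \pi_Q x = \pi_Q y <-> N (x^-1 * y)%g.
Proof.
by split=> [/eqmodP/asboolP//|Nxy]; apply/eqmodP/asboolP.
Qed.

Definition quotient_one : Q := \pi_Q 1%g.
Definition quotient_mul (a b : Q) : Q := \pi_Q (repr a * repr b)%g.
Definition quotient_inv (a : Q) : Q := \pi_Q (repr a)^-1%g.

Lemma pi_mulg (x y : G) : quotient_mul (\pi_Q x) (\pi_Q y) = \pi_Q (x * y)%g.
Proof.
have [_ NM NV] := normal_subgroupP N.
have Nx : N ((repr (\pi_Q x))^-1 * x)%g by apply/eq_cosetP; rewrite reprK.
have Ny : N ((repr (\pi_Q y))^-1 * y)%g by apply/eq_cosetP; rewrite reprK.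
apply/eq_cosetP.
set a := repr _ in Nx *; set b := repr _ in Ny *.
have -> : ((a * b)^-1 * (x * y) = (a^-1 * x) ^ b * (b^-1 * y))%g.
  by rewrite /conjg invgM !mulgA mulgK.
by apply: NM => //; exact: normal_conj.
Qed.

Lemma pi_invg (x : G) : quotient_inv (\pi_Q x) = \pi_Q (x^-1)%g.
Proof.
have [_ NM NV] := normal_subgroupP N.
have Nx : N ((repr (\pi_Q x))^-1 * x)%g by apply/eq_cosetP; rewrite reprK.
apply/eq_cosetP; set a := repr _ in Nx *; rewrite invgK.
have -> : (a * x^-1 = ((a^-1 * x)^-1) ^ a^-1)%g.
  by rewrite /conjg invgM !invgK !mulgA mulgK.
by apply: normal_conj; exact: NV.
Qed.

Lemma quotient_mulA : associative quotient_mul.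
Proof.
elim/quotW=> x; elim/quotW=> y; elim/quotW=> z.
by rewrite (pi_mulg y z) (pi_mulg x y) (pi_mulg x) (pi_mulg _ z) mulgA.
Qed.

Lemma quotient_mul1 : left_id quotient_one quotient_mul.
Proof. by move=> a; rewrite -[a]reprK pi_mulg mul1g. Qed.

Lemma quotient_1mul : right_id quotient_one quotient_mul.
Proof. by move=> a; rewrite -[a]reprK pi_mulg mulg1. Qed.

Lemma quotient_mulV : left_inverse quotient_one quotient_inv quotient_mul.
Proof. by move=> a; rewrite -[a]reprK pi_invg pi_mulg mulVg. Qed.

Lemma quotient_Vmul : right_inverse quotient_one quotient_inv quotient_mul.
Proof. by move=> a; rewrite -[a]reprK pi_invg pi_mulg mulgV. Qed.

HB.instance Definition _ := isGroup.Build Q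
  quotient_mulA quotient_mul1 quotient_1mul quotient_mulV quotient_Vmul.

Lemma quotient_pi_open (A : set G) : open A -> open (\pi_Q @` A).
Proof.
have [N1 NM NV] := normal_subgroupP N.
move=> oA; rewrite /open/= /quotient_open.
have -> : \pi_Q @^-1` (\pi_Q @` A) =
    \bigcup_(z in (normal_set N)) ((fun x => x * z)%g @^-1` A).
  apply/seteqP; split => [x [a Aa /eq_cosetP/NV]|x [z Nz /= Axz]].
    rewrite invgM invgK => Nxa.
    by exists (x^-1 * a)%g => //=; rewrite mulVKg.
  by exists (x * z)%g => //; apply/eq_cosetP; rewrite invgM mulgVK; exact: NV.
apply: bigcup_open => z _; apply: open_comp => // x _.
exact: mulgr_continuous.
Qed.

Lemma quotient_mul_continuous : continuous (fun ab : Q * Q => (ab.1 * ab.2)%g).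
Proof.
move=> [a b]; rewrite -[a]reprK -[b]reprK => A /=.
rewrite [(_ * _)%g]pi_mulg => /pi_continuous.
move=> /(mulg_continuous (repr a, repr b))[[B C] /= [nB nC] BC].
exists (\pi_Q @` B^°, \pi_Q @` C^°) => /=.
  split; apply: open_nbhs_nbhs; split.
  - by apply: quotient_pi_open; exact: open_interior.
  - by exists (repr a).
  - by apply: quotient_pi_open; exact: open_interior.
  - by exists (repr b).
move=> [_ _] [/= [x Bx <-] [y Cy <-]]; rewrite [(_ * _)%g]pi_mulg.
by apply: (BC (x, y)); split; exact: interior_subset.
Qed.

Lemma quotient_inv_continuous : continuous (fun a : Q => a^-1%g).
Proof.
apply/quotient_continuous => x.
have -> : (fun a : Q => a^-1)%g \o \pi_Q = \pi_Q \o (fun x => x^-1)%g.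
  by apply/funext => y; exact: pi_invg.
apply: continuous_comp; [exact: invg_continuous|exact: pi_continuous].
Qed.

HB.instance Definition _ := isTopologicalGroup.Build Q
  quotient_mul_continuous quotient_inv_continuous.

End QuotientGroup.

Section Filtrations.
Variable G : topGroupType.

Definition closed_gen (A : set G) : set G := smallest (@closed_subgroup G) A.

Lemma closed_gen_closed_subgroup (A : set G) : closed_subgroup (closed_gen A).
Proof.
split; first by apply: closed_bigI => H [[]].
split=> [H [[_ []]]//|x y Hx Hy H HP|x Hx H HP].
  by case: (HP) => -[_ [_ HM _]] _; apply: HM; [exact: Hx|exact: Hy].
by case: (HP) => -[_ [_ _ HV]] _; apply: HV; exact: Hx.
Qed.

Lemma closed_gen_conj (A : set G) :
    (forall x y, A x -> A (x ^ y)%g) ->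
  forall x y, closed_gen A x -> closed_gen A (x ^ y)%g.
Proof.
move=> AJ x y; have [clA [A1 AM AV]] := closed_gen_closed_subgroup A.
apply: (_ : _ `<=` [set x | closed_gen A (x ^ y)%g]); apply: smallest_sub.
  split.
    by apply: (@preimage_closed _ _ (fun x => x ^ y)%g) => // z _;
      exact: conjg_continuous.
  split => /=; first by rewrite conj1g.
    by move=> a b Aa Ab; rewrite conjMg; exact: AM.
  by move=> a Aa; rewrite conjVg; exact: AV.
by move=> a Aa; apply: sub_gen_smallest; exact: AJ.
Qed.

(* [lower_central i] is G^(i) for i >= 1; the value at 0 is not used. *)
Definition lower_central (i : nat) : set G :=
  iter i.-1 (fun H => closed_gen [set [~ x, y]%g | x in [set: G] & y in H])
    [set: G].

Lemma lower_central_conj i x y :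
  lower_central i x -> lower_central i (x ^ y)%g.
Proof.
rewrite /lower_central; elim: i.-1 x y => //= k IH x y.
apply: closed_gen_conj => _ z [a _ [b Hb <-]].
by rewrite conjRg; exists (a ^ z)%g => //; exists (b ^ z)%g => //; exact: IH.
Qed.

Definition zassenhaus_gens (p n : nat) : set G :=
  [set z | exists i j (x : G), [/\ (0 < i)%N, (n <= i * p ^ j)%N,
     lower_central i x & z = (x ^+ (p ^ j))%g]].

Lemma zassenhaus_conj p n x y :
  closed_gen (zassenhaus_gens p n) x ->
  closed_gen (zassenhaus_gens p n) (x ^ y)%g.
Proof.
apply: closed_gen_conj => _ z [i [j [a [i0 nij Ha ->]]]].
exists i, j, (a ^ z)%g; split => //; first exact: lower_central_conj.
by rewrite conjXg.
Qed.

Definition zassenhaus (p n : nat) : normal_subgroup G :=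
  NormalSubgroup (closed_gen_closed_subgroup (zassenhaus_gens p n)).2
    (@zassenhaus_conj p n).

End Filtrations.

Lemma continuous_discreteP (T : topologicalType) (A : choiceType)
    (f : T -> discrete_topology A) :
  continuous f <-> forall x, \forall y \near x, f y = f x.
Proof.
have P x := @discrete_cvg (discrete_topology A) (f @ x) (f x) (fmap_filter f (nbhs_filter x)).
by split=> cf x; [have [+ _] := P x | have [_ +] := P x]; apply; exact: cf.
Qed.

Section Cohomology.
Variables (p : nat) (G : topGroupType).

Definition cocycle2 : pred (G * G -> 'Z_p) := fun c =>
  `[< continuous (c : G * G -> discrete_topology 'Z_p) /\
      forall x y z, c (y, z) - c ((x * y)%g, z) + c (x, (y * z)%g) - c (x, y)
        = 0 >].

Lemma cocycle2_zmod_closed : zmod_closed cocycle2.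
Proof.
split=> [|c d /asboolP[/continuous_discreteP cc cE]
              /asboolP[/continuous_discreteP dc dE]].
  apply/asboolP; split; first by move=> x; exact: cvg_cst.
  by move=> x y z; rewrite !subr0 addr0.
apply/asboolP; split.
  apply/continuous_discreteP => x; near=> y.
  change (c y - d y = c x - d x).
  have -> : c y = c x by near: y; exact: cc.
  by have -> : d y = d x by near: y; exact: dc.
move=> x y z; have subE u : (c - d) u = c u - d u by [].
rewrite !subE -[RHS]subr0 -{1}(cE x y z) -(dE x y z); ring.
Unshelve. all: by end_near. Qed.

HB.instance Definition _ :=
  GRing.isZmodClosed.Build (G * G -> 'Z_p) cocycle2 cocycle2_zmod_closed.

Record Z2 := MkZ2 { Z2_val :> G * G -> 'Z_p; _ : Z2_val \in cocycle2 }.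

HB.instance Definition _ := [isSub for Z2_val].
HB.instance Definition _ := [Choice of Z2 by <:].
HB.instance Definition _ := [SubChoice_isSubZmodule of Z2 by <:].

Definition coboundary2 : pred Z2 := fun c =>
  `[< exists f : G -> 'Z_p, continuous (f : G -> discrete_topology 'Z_p) /\
      forall x y, c (x, y) = f y - f (x * y)%g + f x >].

Lemma coboundary2_zmod_closed : zmod_closed coboundary2.
Proof.
split=> [|c d /asboolP[f [/continuous_discreteP fc cE]]
              /asboolP[g [/continuous_discreteP gc dE]]].
  apply/asboolP; exists (fun=> 0); split; first by move=> x; exact: cvg_cst.
  by move=> x y; rewrite subr0 addr0.
apply/asboolP; exists (fun x => f x - g x); split.
  apply/continuous_discreteP => x; near=> y.
  have -> : f y = f x by near: y; exact: fc.
  by have -> : g y = g x by near: y; exact: gc.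
move=> x y; have -> : (c - d) (x, y) = c (x, y) - d (x, y) by [].
by rewrite cE dE; ring.
Unshelve. all: by end_near. Qed.

HB.instance Definition _ :=
  GRing.isZmodClosed.Build Z2 coboundary2 coboundary2_zmod_closed.

Definition B2 : zmodClosed Z2 := GRing.ZmodClosed.clone Z2 coboundary2 _.

Definition H2 : zmodType := {ideal_quot B2}.

(* The class of c if c is a continuous 2-cocycle (and 0 otherwise). *)
Definition class2 (c : G * G -> 'Z_p) : H2 :=
  \pi_{ideal_quot B2} (insubd (0 : Z2) c).

End Cohomology.

(* Meant for a continuous homomorphism f, for which the result does not depend
   on the representative. *)
Definition pullback2 (p : nat) (G H : topGroupType) (f : G -> H)
    (xi : H2 p H) : H2 p G :=
  class2 (fun xy => repr (xi : {ideal_quot @B2 p H}) (f xy.1, f xy.2)).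

(* The cocycle c is defined by [s(x) s(y) = c(x, y) s(xy)] for the section s = repr of U -> U/N; theta is
   the identification of N with Z/p. *)
Definition extension_class (p : nat) (U : topGroupType) (N : normal_subgroup U)
    (theta : U -> 'Z_p) : H2 p (quotient_group N) :=
  class2 (fun xy : quotient_group N * quotient_group N =>
    theta (repr xy.1 * repr xy.2 * (repr (xy.1 * xy.2)%g)^-1)%g).

Section Unitriangular.
Variables (R : finComUnitRingType) (m : nat).

Definition unitriangular (M : 'M[R]_m.+1) : bool :=
  [forall k : 'I_m.+1, forall l : 'I_m.+1,
     (l <= k)%N ==> (M k l == (k == l)%:R)].

Lemma unitriangularP (M : 'M[R]_m.+1) :
  reflect (forall k l : 'I_m.+1, (l <= k)%N -> M k l = (k == l)%:R)
    (unitriangular M).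
Proof.
apply: (iffP forallP) => [H k l lk|H k].
  by have /forallP/(_ l)/implyP/(_ lk)/eqP := H k.
by apply/forallP => l; apply/implyP => lk; apply/eqP/H.
Qed.

Lemma unitriangular_unit (M : 'M[R]_m.+1) : unitriangular M -> M \in unitmx.
Proof.
move=> /unitriangularP H; rewrite -unitmx_tr unitmxE det_trig.
  by rewrite big1 ?unitr1// => k _; rewrite mxE H// eqxx.
apply/is_trig_mxP => k l kl; rewrite mxE H ?(ltnW kl)//.
by case: eqP kl => // ->; rewrite ltnn.
Qed.

Definition unitriangular_set : {set {'GL_m.+1[R]}} :=
  [set A : {'GL_m.+1[R]} | unitriangular (val A)]%SET.

Lemma unitriangular_group_set : group_set unitriangular_set.
Proof.
apply/group_setP; split=> [|A B]; rewrite !inE.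
  by apply/unitriangularP => k l _; rewrite mxE.
move=> /unitriangularP HA /unitriangularP HB.
apply/unitriangularP => k l lk; rewrite mxE.
rewrite (bigD1 k)//= HA// eqxx mul1r HB// big1 ?addr0// => a ak.
have [ka|ak'] := ltnP k a; last by rewrite HA// eq_sym (negPf ak) mul0r.
rewrite HB ?(leq_trans lk (ltnW ka))// (_ : (a == l) = false) ?mulr0//.
by apply/eqP => al; move: ka; rewrite al ltnNge lk.
Qed.

Canonical unitriangular_group := Group unitriangular_group_set.

Definition UU : topGroupType := discrete_topology [subg unitriangular_group].

Definition mx_of_UU (A : UU) : 'M[R]_m.+1 := val (val (A : [subg unitriangular_group])).

(* Defaults to 1 if M is not unitriangular. *)
Definition UU_of_mx (M : 'M[R]_m.+1) : UU :=
  subg unitriangular_group (insubd (1%g : {'GL_m.+1[R]}) M).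

Lemma UU_of_mxK (M : 'M[R]_m.+1) : unitriangular M -> mx_of_UU (UU_of_mx M) = M.
Proof.
move=> HM; have uM : M \is a GRing.unit by exact: unitriangular_unit.
have vM : val (insubd (1%g : {'GL_m.+1[R]}) M) = M by rewrite val_insubd uM.
by rewrite /mx_of_UU /UU_of_mx /= subgK ?inE vM.
Qed.

Lemma mx_of_UU_inj : injective mx_of_UU.
Proof. by move=> A B /val_inj/val_inj. Qed.

Lemma mx_of_UUP (A : UU) : unitriangular (mx_of_UU A).
Proof. by have := valP (A : [subg unitriangular_group]); rewrite inE. Qed.

Lemma mx_of_UUM (A B : UU) : mx_of_UU (A * B)%g = mx_of_UU A *m mx_of_UU B.
Proof. by []. Qed.

Lemma mx_of_UU1 : mx_of_UU 1%g = 1%:M.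
Proof. by []. Qed.

(* The subgroup I + c Z E_{1,m+1}; rows and columns are numbered from 0. *)
Variable c : nat.

Local Notation E := (delta_mx ord0 ord_max : 'M[R]_m.+1).

Definition corner_mx (a : int) : 'M[R]_m.+1 :=
  1%:M + (c%:R * a%:~R) *: E.

Definition corner_set : set UU := [set A | exists a, mx_of_UU A = corner_mx a].

Lemma delta_UU (A : UU) :
  mx_of_UU A *m E = E.
Proof.
have /unitriangularP H := mx_of_UUP A.
apply/matrixP => k l; rewrite mxE (bigD1 ord0)//= !mxE eqxx /= H//.
rewrite big1 ?addr0 => [|a /negPf a0]; last by rewrite mxE a0 mulr0.
by rewrite mulr_natl mulrb; case: (k == ord0).
Qed.

Lemma UU_delta (A : UU) :
  E *m mx_of_UU A = E.
Proof.
have /unitriangularP H := mx_of_UUP A.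
apply/matrixP => k l; rewrite mxE (bigD1 ord_max)//= !mxE eqxx andbT.
rewrite H ?leq_ord// big1 ?addr0 => [|a /negPf a0]; last first.
  by rewrite mxE a0 andbF mul0r.
by rewrite [ord_max == l]eq_sym -natrM mulnb.
Qed.

Lemma corner_central (A B : UU) : corner_set A -> (A * B = B * A)%g.
Proof.
move=> [a Aa]; apply: mx_of_UU_inj; rewrite !mx_of_UUM Aa.
by rewrite mulmxDl mulmxDr mul1mx mulmx1 -scalemxAl -scalemxAr UU_delta delta_UU.
Qed.

Lemma corner_subgroup : is_subgroup corner_set.
Proof.
have M A a : mx_of_UU A = corner_mx a -> forall B b,
    mx_of_UU B = corner_mx b -> mx_of_UU (A * B)%g = corner_mx (a + b).
  move=> Aa B b Bb; rewrite mx_of_UUM Aa mulmxDl mul1mx -scalemxAl UU_delta Bb.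
  by rewrite /corner_mx -addrA -scalerDl -mulrDr [b%:~R + _]addrC rmorphD.
split=> [|A B [a Aa] [b Bb]|A [a Aa]].
- by exists 0; rewrite mx_of_UU1 /corner_mx mulr0 scale0r addr0.
- by exists (a + b); exact: M.
- exists (- a); have : mx_of_UU (A * A^-1)%g = 1%:M by rewrite mulgV.
  rewrite mx_of_UUM Aa mulmxDl mul1mx -scalemxAl UU_delta.
  move/(canRL (addrK _)) ->.
  by rewrite /corner_mx rmorphN mulrN scaleNr.
Qed.

Lemma corner_conj A B : corner_set A -> corner_set (A ^ B)%g.
Proof. by move=> cA; rewrite /conjg (corner_central _ cA) mulKg. Qed.

Definition corner : normal_subgroup UU :=
  NormalSubgroup corner_subgroup corner_conj.

End Unitriangular.

Definition converges_to_1 (X : Type) (G : topGroupType) (f : X -> G) : Prop :=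
  forall H : set G, open H -> is_subgroup H -> finite_set [set x | ~ H (f x)].

(* The extension f is unique by the second condition. *)
Definition free_profinite (X : Type) (S : profiniteGroupType) (iota : X -> S)
    : Prop :=
  [/\ converges_to_1 iota,
      closed_gen (range iota) = [set: S] &
      forall (G : profiniteGroupType) (phi : X -> G), converges_to_1 phi ->
        exists f : S -> G, continuous_hom f /\ forall x, f (iota x) = phi x].

Section Magnus.
Variables (X : choiceType) (R : comNzRingType).

(* R<<X>> for finite (hence discrete) R: a series is its coefficient function,
   and the topology is that of coefficientwise convergence. *)
Definition series : Type := {ptws seq X -> discrete_topology R}.

HB.instance Definition _ := Topological.on series.

Definition series_one : series := fun w => (w == [::])%:R : R.

Definition series_var (x : X) : series := fun w => (w == [:: x])%:R : R.

Definition series_add (f g : series) : series := fun w => (f w : R) + (g w : R).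

Definition series_mul (f g : series) : series := fun w =>
  \sum_(k < (size w).+1) (f (take k w) : R) * (g (drop k w) : R).

Variables (S : profiniteGroupType) (iota : X -> S).

(* The values are units: L is a monoid morphism defined on a group. *)
Definition is_magnus (L : S -> series) : Prop :=
  [/\ continuous L,
      L 1%g = series_one,
      forall s t, L (s * t)%g = series_mul (L s) (L t) &
      forall x, L (iota x) = series_add series_one (series_var x)].

(* There is exactly one such L when iota is a basis: existence by freeness,
   since x |-> 1 + x converges to 1, and uniqueness because iota generates. *)
Definition magnus : S -> series := xget (fun=> series_one) [set L | is_magnus L].

Definition magnus_coef (w : seq X) (s : S) : R := magnus s w.

End Magnus.

Definition jindex (p n i : nat) : nat :=
  find (fun j => n <= i * p ^ j)%N (iota 0 n).

Lemma jindexP p n i : prime p -> (0 < i)%N ->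
  (n <= i * p ^ jindex p n i)%N /\
  (forall j, (n <= i * p ^ j)%N -> (jindex p n i <= j)%N).
Proof.
move=> p_pr i0; set a := (fun j => n <= i * p ^ j)%N.
have an : a n.
  apply: leq_trans (ltnW (ltn_expl n (prime_gt1 p_pr))) _.
  by rewrite leq_pmull.
have le_n : (jindex p n i <= n)%N by rewrite -[leqRHS](size_iota 0 n) find_size.
split=> [|j aj].
  have [lt_n|] := ltnP (jindex p n i) n; last first.
    by move=> ge_n; have /eqP -> : jindex p n i == n by rewrite eqn_leq le_n.
  have H : has a (iota 0 n) by rewrite has_find size_iota.
  by have := nth_find 0 H; rewrite nth_iota.
rewrite leqNgt; apply/negP => lt_j.
have := before_find 0 lt_j; rewrite nth_iota ?(leq_trans lt_j)// add0n.
by move=> /negP.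
Qed.

Definition ceil_div (n d : nat) : nat := ((n + d.-1) %/ d)%N.

(* i belongs to J(n) *)
Definition JJ (p n i : nat) : Prop :=
  [/\ (1 <= i)%N, (i <= n)%N & exists k, i = ceil_div n (p ^ k)].

Section Alpha.
Variables (p n : nat) (X : choiceType) (S : profiniteGroupType).
Variables (bas : X -> S) (w : seq X).

Let m := size w.
Let j := jindex p n m.

Definition alpha_ring : finComUnitRingType := 'Z_(p ^ j.+1).

Definition alpha_UU : topGroupType := UU alpha_ring m.

Definition alpha_corner : normal_subgroup alpha_UU :=
  corner alpha_ring m (p ^ j).

(* Entry p^j a mod p^(j+1) of the corner is sent to a mod p. *)
Definition corner_coord (A : alpha_UU) : 'Z_p :=
  ((mx_of_UU A ord0 ord_max : nat) %/ p ^ j)%:R.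

Definition gamma : H2 p (quotient_group alpha_corner) :=
  extension_class alpha_corner corner_coord.

(* With indices from 0, the (k,l) entry is the coefficient at the subword of w
   from position k included to l excluded.  The matrix is unitriangular, since
   magnus has constant term 1 on a basis. *)
Definition rho (s : S) : alpha_UU :=
  UU_of_mx (\matrix_(k < m.+1, l < m.+1)
    if (k <= l)%N then magnus_coef alpha_ring bas (drop k (take l w)) s else 0).

(* Independent of the representative: rho maps S_(n,p) into the corner. *)
Definition rho_bar (x : quotient_group (zassenhaus S p n)) :
    quotient_group alpha_corner :=
  \pi_(quotient_group alpha_corner) (rho (repr x)).

Definition alpha : H2 p (quotient_group (zassenhaus S p n)) :=
  pullback2 rho_bar gamma.

End Alpha.

(* An element of Z<X> is its coefficient function.  Letter a of u ++ v goes to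
   position s a. *)
Definition shuffle (X : eqType) (u v : seq X) (w : seq X) : int :=
  let N := size (u ++ v) in let uv := in_tuple (u ++ v) in
  \sum_(s : 'S_N | [forall a : 'I_N, forall b : 'I_N,
        [&& (a < b)%N & (b < size u)%N || (size u <= a)%N] ==> (s a < s b)%N])
    (w == [tuple tnth uv ((s^-1)%g k) | k < N] :> seq X)%:R.

(* Main.v *)
(** The coefficients of the Magnus map satisfy
    [eps_u(s) eps_v(s) = sum_w (u infil v)_w eps_w(s)], where [infil] is the
    infiltration product, whose part in length [|u| + |v|] is the shuffle
    product: both sides are compatible with the product of [S], and they agree
    on the basis.  On [S_(n,p)] the coefficient [eps_w] is divisible by
    [p ^ j_n(|w|)], and [i \in J(n)] forces [j_n(i') > j_n(i)] for [i' < i].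
    Hence modulo [p ^ (j_n(i) + 1)] the coefficients at words shorter than [i]
    are functions on [S/S_(n,p)], and so is
    [F = sum_(|w| = i) (u shuffle v)_w eps_w].  The class [alpha_w] is
    represented, after embedding [Z/p] as [p ^ j_n(i) Z/p ^ (j_n(i) + 1)], by
    [eps_w(r x r y) - eps_w(r (x y))] up to an explicit coboundary, for any
    section [r] of [S -> S/S_(n,p)].  Summing with the shuffle coefficients
    leaves [F(r x r y) - F(r (x y)) = 0]. *)
From mathcomp Require Import all_boot all_order all_algebra fingroup perm.
From mathcomp Require Import all_classical.
From mathcomp Require Import generic_quotient ring_quotient topology.
From mathcomp Require Import zify ring.
Require Import Defs.

Set Implicit Arguments.
Unset Strict Implicit.
Unset Printing Implicit Defensive.

Import Order.TTheory GRing.Theory.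

Local Open Scope classical_set_scope.
Local Open Scope quotient_scope.
Local Open Scope ring_scope.

(** * Infiltration and shuffles *)

Section Infiltration.
Variable X : eqType.
Implicit Types u v w : seq X.

(** The infiltration product of Chen, Fox and Lyndon, as a list with multiplicities; the last branch
    merges two equal first letters. *)
Fixpoint infiltration u : seq X -> seq (seq X) :=
  if u is a :: u' then
    fix infil_u v := if v is b :: v' then
        [seq a :: w | w <- infiltration u' v] ++
        [seq b :: w | w <- infil_u v'] ++
        (if a == b then [seq a :: w | w <- infiltration u' v'] else [::])
      else [:: u]
  else fun v => [:: v].

Lemma infiltration0r u : infiltration u [::] = [:: u].
Proof. by case: u. Qed.

Lemma infiltration_cons a b u v : infiltration (a :: u) (b :: v) =
  [seq a :: w | w <- infiltration u (b :: v)] ++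
  [seq b :: w | w <- infiltration (a :: u) v] ++
  (if a == b then [seq a :: w | w <- infiltration u v] else [::]).
Proof. by []. Qed.

Lemma infiltration_ind (P : seq X -> seq X -> Prop) :
  (forall v, P [::] v) -> (forall u, P u [::]) ->
  (forall a b u v, P u (b :: v) -> P (a :: u) v -> P u v ->
     P (a :: u) (b :: v)) ->
  forall u v, P u v.
Proof.
move=> P0l P0r Pcons; elim=> [|a u IHu] // v.
by elim: v => // b v IHv; apply: Pcons.
Qed.

Lemma size_infiltration u v w :
  w \in infiltration u v -> (size w <= size u + size v)%N.
Proof.
move: u v w; apply: infiltration_ind => [v w|u w|a b u v IH1 IH2 IH3 w].
- by rewrite inE => /eqP->.
- by rewrite infiltration0r inE addn0 => /eqP->.
rewrite infiltration_cons !mem_cat.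
case/or3P => [/mapP[t /IH1 + ->]|/mapP[t /IH2 + ->]|].
- by rewrite /=; lia.
- by rewrite /=; lia.
by case: eqP => // _ /mapP[t /IH3 + ->] /=; lia.
Qed.

Lemma infiltration_neq_nil u v w :
  u <> [::] -> w \in infiltration u v -> w <> [::].
Proof.
case: u => // a u _; case: v => [|b v]; first by rewrite inE => /eqP ->.
rewrite infiltration_cons !mem_cat => /or3P[/mapP[t _ ->]|/mapP[t _ ->]|] //.
by case: eqP => // _ /mapP[t _ ->].
Qed.

(** Maximal length means that no two letters were merged. *)
Definition shuffles u v : seq (seq X) :=
  [seq w <- infiltration u v | size w == size u + size v]%N.

Lemma shuffles0l v : shuffles [::] v = [:: v].
Proof. by rewrite /shuffles /= eqxx. Qed.

Lemma shuffles0r u : shuffles u [::] = [:: u].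
Proof. by rewrite /shuffles infiltration0r /= addn0 eqxx. Qed.

(** A merged word is too short to pass the length filter, which leaves the usual recursion. *)
Lemma shuffles_cons a b u v : shuffles (a :: u) (b :: v) =
  [seq a :: w | w <- shuffles u (b :: v)] ++
  [seq b :: w | w <- shuffles (a :: u) v].
Proof.
rewrite /shuffles infiltration_cons !filter_cat !filter_map.
rewrite [X in _ ++ _ ++ X](_ : _ = [::]) ?cats0; last first.
  apply/eqP; rewrite -[_ == _]negbK -has_filter -all_predC; apply/allP => t /=.
  case: eqP => // _ /mapP[t' /size_infiltration + ->] /=; lia.
by congr (map _ _ ++ map _ _); apply: eq_filter => t /=; rewrite ?addnS ?addSn.
Qed.

Lemma size_shuffles u v w : w \in shuffles u v -> size w = (size u + size v)%N.
Proof. by rewrite mem_filter => /andP[/eqP]. Qed.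

End Infiltration.

(** * Shuffles as permutations *)

Section ShufflePermutations.

Definition shuffle_perm N r (s : 'S_N) : bool :=
  [forall a : 'I_N, forall b : 'I_N,
     [&& (a < b)%N & (b < r)%N || (r <= a)%N] ==> (s a < s b)%N].

Lemma shuffle_permP N r (s : 'S_N) :
  reflect (forall a b : 'I_N, (a < b)%N -> (b < r)%N || (r <= a)%N ->
             (s a < s b)%N)
    (shuffle_perm r s).
Proof.
apply: (iffP forallP) => [H a b ab br|H a].
  by have /forallP/(_ b)/implyP := H a; apply; rewrite ab.
by apply/forallP => b; apply/implyP => /andP[]; exact: H.
Qed.

(** A permutation is given by the index sent to 0 and a permutation of the rest; injectivity of [h]
    and equality of cardinals make this a bijection. *)
Lemma big_lift_perm (V : nmodType) N (F : 'S_N.+1 -> V) :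
  \sum_s F s = \sum_(i < N.+1) \sum_(s : 'S_N) F (lift_perm i ord0 s).
Proof.
pose h (is_ : 'I_N.+1 * 'S_N) := lift_perm is_.1 ord0 is_.2.
have h_inj : injective h.
  move=> [i s] [i' s'] /= /permP hE.
  have ii' : i = i'.
    apply: (@perm_inj _ (lift_perm i ord0 s)).
    by rewrite [RHS]hE /= !lift_perm_id.
  rewrite -{i'}ii' in hE *; congr pair; apply/permP => k.
  by apply: (@lift_inj _ ord0); have := hE (lift i k); rewrite /= !lift_perm_lift.
rewrite pair_big (reindex h) //=.
apply: onW_bij; apply: inj_card_bij => //.
by rewrite card_prod card_ord !card_Sn factS.
Qed.

(* The preimage of 0 under a shuffle is the first index of one of the two
   blocks. *)
Lemma shuffle_perm_lift N r (s : 'S_N) (i : 'I_N.+1) : (r <= N.+1)%N ->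
  shuffle_perm r (lift_perm i ord0 s) =
    ((i == 0 :> nat) && (0 < r) && shuffle_perm r.-1 s ||
     (i == r :> nat) && shuffle_perm r s)%N.
Proof.
move=> rN; set t := lift_perm _ _ _.
have ti : t i = ord0 by rewrite lift_perm_id.
have tl k : t (lift i k) = (s k).+1 :> nat by rewrite lift_perm_lift.
have lift_shuffle q : (forall a b : 'I_N, (bump i b < r) || (r <= bump i a) ->
      (b < q) || (q <= a))%N ->
      (i == 0 :> nat)%N && (0 < r)%N || (i == r :> nat)%N ->
    shuffle_perm q s -> shuffle_perm r t.
  move=> qr ir /shuffle_permP sh; apply/shuffle_permP => a b.
  case: (unliftP i a) => [a'|] ->; case: (unliftP i b) => [b'|] -> //.
  - rewrite !tl ltnS => ab br; apply: sh; last exact: qr.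
    by rewrite /= /bump in ab; lia.
  - by rewrite /= => ab; move: ir; rewrite /bump in ab *; lia.
  - by move=> _ _; rewrite ti tl.
  - by rewrite ltnn.
have shuffle_unlift q : (forall a b : 'I_N, (a < b)%N -> (b < q) || (q <= a) ->
      (bump i b < r) || (r <= bump i a))%N ->
    shuffle_perm r t -> shuffle_perm q s.
  move=> qr /shuffle_permP sh; apply/shuffle_permP => a b ab bq.
  have := sh (lift i a) (lift i b); rewrite !tl ltnS; apply; last exact: qr.
  by rewrite /= /bump; lia.
apply/idP/orP => [sh|[/andP[/andP[/eqP i0 r0]]|/andP[/eqP ir]]].
- have /shuffle_permP shP := sh.
  have [i0|i0] := posnP i.
    have [r0|r0] := posnP r; last first.
      by left => /=; apply: shuffle_unlift sh => a b; rewrite i0 /bump; lia.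
    right; rewrite i0 r0 eqxx /=; apply: shuffle_unlift sh => a b.
    by rewrite /bump; lia.
  right; have [ir|ri|ir] := ltngtP i r.
  + by have := shP ord0 i i0; rewrite ir ti => /(_ isT).
  + have rN' : (r < N.+1)%N := ltn_trans ri (ltn_ord i).
    by have := shP (Ordinal rN') i ri; rewrite /= leqnn orbT ti => /(_ isT).
  by apply: shuffle_unlift sh => a b; rewrite /bump; lia.
- by apply: lift_shuffle; rewrite ?i0 ?r0 // => a b; rewrite /bump; lia.
- by apply: lift_shuffle; rewrite ?ir ?eqxx ?orbT // => a b; rewrite /bump; lia.
Qed.

Variables (X : eqType) (V : nmodType).

(** Induction on [N] over the index sent to position 0, which is 0 or [r]: the two branches of the
    shuffle recursion. Letters form a function on [nat], so that deleting index [i] is composition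
    with [bump i]. *)
Lemma sum_shuffle_perm N r (W : nat -> X) (f : seq X -> V) : (r <= N)%N ->
  \sum_(s : 'S_N | shuffle_perm r s) f [seq W (s^-1 k)%g | k <- enum 'I_N] =
  \sum_(w <- shuffles (mkseq W r) (mkseq (fun k => W (r + k)%N) (N - r))) f w.
Proof.
elim: N r W f => [|N IH] r W f rN.
  have -> : r = 0%N by lia.
  rewrite shuffles0l big_seq1 (big_pred1 1%g) => [|s].
    by congr f; apply: size0nil; rewrite size_map size_enum_ord.
  apply/shuffle_permP/eqP => [_|_ []//].
  by apply/permP => -[].
have step (i : 'I_N.+1) (s : 'S_N) :
    [seq W ((lift_perm i ord0 s)^-1 k)%g | k <- enum 'I_N.+1] =
    W i :: [seq (W \o bump i) (s^-1 k)%g | k <- enum 'I_N].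
  rewrite lift_permV enum_ordSl /= lift_perm_id; congr cons.
  by rewrite -map_comp; apply: eq_map => k /=; rewrite lift_perm_lift.
pose A (i q : nat) := \sum_(w <- shuffles (mkseq (W \o bump i) q)
    (mkseq (fun k => (W \o bump i) (q + k)%N) (N - q))) f (W i :: w).
have AE (i : 'I_N.+1) q : (q <= N)%N -> \sum_(s : 'S_N | shuffle_perm q s)
      f (W i :: [seq (W \o bump i) (s^-1 k)%g | k <- enum 'I_N]) = A i q.
  by move=> qN; exact: (IH _ _ (fun w => f (W i :: w))).
have mkseq_cons (F : nat -> X) m : mkseq F m.+1 = F 0%N :: mkseq (F \o S) m.
  rewrite /mkseq -[m.+1]add1n iotaD map_cat //=; congr cons.
  by rewrite add0n -[1%N]addn0 iotaDl -map_comp.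
have mkseq_bump i : mkseq (W \o bump i) i = mkseq W i.
  apply/eq_in_map => k; rewrite mem_iota /= => ki.
  by rewrite /= /bump leqNgt ki.
have shift_bump i : (fun k => (W \o bump i) (i + k)%N) = (fun k => W (i + k.+1)%N).
  by apply/funext => k; rewrite /= /bump leq_addr addnS.
rewrite big_mkcond big_lift_perm (eq_bigr (fun i : 'I_N.+1 =>
   (if (i == 0 :> nat)%N && (0 < r)%N then A i r.-1 else 0) +
   (if (i == r :> nat)%N then A i r else 0))); last first.
  move=> i _; under eq_bigr => s _ do rewrite shuffle_perm_lift // step.
  rewrite -big_mkcond /=; case: ifPn => /= [/andP[/eqP i0 r0]|_].
    rewrite i0 ifF ?addr0; last by rewrite eq_sym; apply/eqP => r00; rewrite r00 in r0.
    by rewrite -i0 -AE; [apply: eq_bigl => s; case: eqP => /=; lia|lia].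
  rewrite add0r; case: ifPn => /= [/eqP ir|_]; last by rewrite big_pred0.
  by rewrite AE // -ltnS -ir.
rewrite big_split /= big_ord_recl [X in _ + X + _]big1 // addr0.
case: r rN => [|r] rN /=.
  rewrite add0r big_ord_recl big1 // addr0 /= /A subn0 shift_bump.
  by rewrite !shuffles0l !big_seq1 (mkseq_cons _ N).
have -> : mkseq W r.+1 = W 0%N :: mkseq (W \o bump 0) r by rewrite mkseq_cons.
(* If [r = N] the second block is empty and only index 0 contributes. *)
have [rN'|rN'] := ltnP r N; last first.
  have rE : r = N by lia.
  rewrite /A rE !subnn [X in _ + X]big1 ?addr0 => [|i _]; last first.
    by rewrite ifF //; have := ltn_ord i; lia.
  by rewrite !shuffles0r !big_seq1.
have rN1 : (r.+1 < N.+1)%N by [].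
rewrite -big_mkcond (big_pred1 (Ordinal rN1)) //= /A mkseq_bump shift_bump.
have -> : (N.+1 - r.+1 = (N - r.+1).+1)%N by lia.
have -> : (N - r = (N - r.+1).+1)%N by lia.
by rewrite !mkseq_cons addn0 shuffles_cons big_cat !big_map /=.
Qed.

End ShufflePermutations.

Lemma shuffleE (X : eqType) (u v w : seq X) : u <> [::] ->
  shuffle u v w = (count_mem w (shuffles u v))%:R.
Proof.
move=> u0; rewrite -sum1_count natr_sum big_mkcond /=.
have x0 : X by case: u u0.
set uv := u ++ v; pose W k := nth x0 uv k.
have uN : (size u <= size uv)%N by rewrite size_cat leq_addr.
have := sum_shuffle_perm W (fun t => (w == t)%:R : int) uN.
have -> : mkseq W (size u) = u.
  rewrite -[RHS](take_size_cat v (erefl (size u))).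
  by rewrite -(mkseq_nth x0 (take _ _)) size_takel //; apply/eq_in_map => k;
    rewrite mem_iota /= => ku; rewrite /W nth_take.
have -> : mkseq (fun k => W (size u + k)%N) (size uv - size u) = v.
  rewrite -[RHS](drop_size_cat (s1 := u) v (erefl (size u))).
  by rewrite -(mkseq_nth x0 (drop _ _)) size_drop; apply: eq_map => k;
    rewrite nth_drop.
move=> H; transitivity (\sum_(t <- shuffles u v) (w == t)%:R : int); last first.
  by apply: eq_bigr => t _; rewrite eq_sym; case: eqP.
rewrite -{}H; apply: eq_bigr => s _; congr (_ == _)%:R.
by apply: eq_map => k; rewrite (tnth_nth x0).
Qed.

(** * The infiltration relation for Magnus coefficients *)

Section SeriesMul.
Variables (X : choiceType) (R : comNzRingType).
Implicit Types (f g : series X R) (u v w : seq X).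

Definition infil_sum f u v : R := \sum_(w <- infiltration u v) (f w : R).

Definition series_shift (a : X) f : series X R := fun w => f (a :: w).

Lemma infil_sum0l f v : infil_sum f [::] v = f v.
Proof. by rewrite /infil_sum big_seq1. Qed.

Lemma infil_sum0r f u : infil_sum f u [::] = f u.
Proof. by rewrite /infil_sum infiltration0r big_seq1. Qed.

Lemma infil_sum_cons f a b u v : infil_sum f (a :: u) (b :: v) =
  infil_sum (series_shift a f) u (b :: v) +
  infil_sum (series_shift b f) (a :: u) v +
  (if a == b then infil_sum (series_shift a f) u v else 0).
Proof.
rewrite /infil_sum infiltration_cons !big_cat /= !big_map addrA.
by congr (_ + _); case: eqP => _; rewrite ?big_map ?big_nil.
Qed.

Lemma series_mul_nil f g : series_mul f g [::] = (f [::] : R) * (g [::] : R) :> R.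
Proof. by rewrite /series_mul big_ord1. Qed.

Lemma series_mul_cons f g a w : series_mul f g (a :: w) =
  (f [::] : R) * (g (a :: w) : R) + series_mul (series_shift a f) g w :> R.
Proof. by rewrite /series_mul big_ord_recl. Qed.

(** Sums over all ways to cut [u] and [v]; equality with [infil_sum (series_mul f g)] expresses that
    deconcatenation is multiplicative for infiltration. *)
Definition infil_conv f g u v : R :=
  \sum_(k < (size u).+1) \sum_(l < (size v).+1)
    infil_sum f (take k u) (take l v) * infil_sum g (drop k u) (drop l v).

Lemma infil_conv_consl f g a u v : infil_conv f g (a :: u) v =
  \sum_(l < (size v).+1) (f (take l v) : R) * infil_sum g (a :: u) (drop l v) +
  \sum_(k < (size u).+1) \sum_(l < (size v).+1)
    infil_sum f (a :: take k u) (take l v) * infil_sum g (drop k u) (drop l v).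
Proof.
rewrite /infil_conv [LHS]big_ord_recl; congr (_ + _).
by apply: eq_bigr => l _; rewrite infil_sum0l.
Qed.

Lemma infil_conv_consr f g b u v : infil_conv f g u (b :: v) =
  \sum_(k < (size u).+1) ((f (take k u) : R) * infil_sum g (drop k u) (b :: v) +
  \sum_(l < (size v).+1)
    infil_sum f (take k u) (b :: take l v) * infil_sum g (drop k u) (drop l v)).
Proof.
by apply: eq_bigr => k _; rewrite [LHS]big_ord_recl /= infil_sum0r.
Qed.

(** The term with two empty prefixes splits off; in the others the first letter of a nonempty prefix
    is removed by the recursion of [infil_sum]. *)
Lemma infil_conv_cons f g a b u v : infil_conv f g (a :: u) (b :: v) =
  (f [::] : R) * infil_sum g (a :: u) (b :: v) +
  (infil_conv (series_shift a f) g u (b :: v) +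
   infil_conv (series_shift b f) g (a :: u) v +
   (if a == b then infil_conv (series_shift a f) g u v else 0)).
Proof.
have -> : (if a == b then infil_conv (series_shift a f) g u v else 0) =
    \sum_(k < (size u).+1) \sum_(l < (size v).+1)
    (if a == b then infil_sum (series_shift a f) (take k u) (take l v) else 0)
      * infil_sum g (drop k u) (drop l v).
  case: eqP => // _.
  by rewrite big1 // => k _; rewrite big1 // => l _; rewrite mul0r.
rewrite (infil_conv_consl f) (infil_conv_consl (series_shift b f)).
rewrite infil_conv_consr big_ord_recl -!addrA; congr (_ + _).
rewrite [RHS]addrCA; congr (_ + _).
rewrite -!big_split; apply: eq_bigr => k _ /=.
rewrite big_ord_recl /= infil_sum0r -!addrA; congr (_ + _).
rewrite -!big_split; apply: eq_bigr => l _ /=.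
by rewrite infil_sum_cons !mulrDl !addrA.
Qed.

(* Induction on the first letters: removing a first letter satisfies the same
   Leibniz rule for [series_mul] as for [infil_conv]. *)
Lemma infil_sum_series_mul f g u v :
  infil_sum (series_mul f g) u v = infil_conv f g u v.
Proof.
move: u v f; apply: infiltration_ind => [v f|u f|a b u v IH1 IH2 IH3 f].
- rewrite infil_sum0l /infil_conv big_ord1.
  by apply: eq_bigr => l _; rewrite /= !infil_sum0l.
- rewrite infil_sum0r /infil_conv.
  by apply: eq_bigr => l _; rewrite big_ord1 /= !infil_sum0r.
have shift_mul c : series_shift c (series_mul f g) =
    series_add (fun w => (f [::] : R) * (g (c :: w) : R))
      (series_mul (series_shift c f) g).
  by apply/funext => w; rewrite [LHS]series_mul_cons.
have sumD c u1 v1 : infil_sum (series_shift c (series_mul f g)) u1 v1 =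
    (f [::] : R) * infil_sum (series_shift c g) u1 v1 +
    infil_sum (series_mul (series_shift c f) g) u1 v1.
  by rewrite shift_mul /infil_sum big_split /= mulr_sumr.
rewrite infil_conv_cons !infil_sum_cons !sumD IH1 IH2 IH3.
by case: eqP => _; ring.
Qed.

End SeriesMul.

Section LocallyConstant.
Variable T : topologicalType.

(** Continuity into a discrete space, phrased without a topology on [A] so that any map out of [A]
    preserves it. *)
Definition locally_constant (A : Type) (f : T -> A) : Prop :=
  forall x, \forall y \near x, f y = f x.

Lemma locally_constant_comp (A B : Type) (h : A -> B) (f : T -> A) :
  locally_constant f -> locally_constant (h \o f).
Proof. by move=> cf x; apply: filterS (cf x) => y /= ->. Qed.

Lemma locally_constant_pair (A B : Type) (f : T -> A) (g : T -> B) :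
  locally_constant f -> locally_constant g ->
  locally_constant (fun x => (f x, g x)).
Proof.
by move=> cf cg x; apply: filterS2 (cf x) (cg x) => y /= -> ->.
Qed.

Lemma locally_constant_op (A B C : Type) (h : A -> B -> C) (f : T -> A)
    (g : T -> B) : locally_constant f -> locally_constant g ->
  locally_constant (fun x => h (f x) (g x)).
Proof.
move=> cf cg; exact: (locally_constant_comp (fun ab => h ab.1 ab.2)
  (locally_constant_pair cf cg)).
Qed.

Lemma locally_constant_sum (I : Type) (V : nmodType) (l : seq I)
    (F : I -> T -> V) : (forall i, locally_constant (F i)) ->
  locally_constant (fun x => \sum_(i <- l) F i x).
Proof.
move=> cF; elim: l => [|i l IH] x.
  by apply: filterE => y; rewrite !big_nil.
by apply: filterS2 (cF i x) (IH x) => y; rewrite !big_cons => -> ->.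
Qed.

Lemma locally_constant_inj (A B : Type) (h : A -> B) (f : T -> A) :
  injective h -> locally_constant (h \o f) -> locally_constant f.
Proof. by move=> h_inj cf x; apply: filterS (cf x) => y /= /h_inj. Qed.

Lemma closed_locally_constant (A : Type) (f : T -> A) (P : A -> Prop) :
  locally_constant f -> closed [set x | P (f x)].
Proof.
move=> cf; rewrite -openC openE => x /= nPx.
by apply: filterS (cf x) => y /= ->.
Qed.

End LocallyConstant.

Lemma closed_gen_sub (G : topGroupType) (A H : set G) :
  closed H -> is_subgroup H -> A `<=` H -> closed_gen A `<=` H.
Proof. by move=> clH sgH; apply: smallest_sub. Qed.

(** * Group-like values of the Magnus map *)

Section Infiltrative.
Variables (X : choiceType) (R : comNzRingType) (S : profiniteGroupType).

(** The last field says that each [L s] is group-like for infiltration. *)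
Record infiltrative (L : S -> series X R) : Prop := Infiltrative {
  infil_continuous : forall w, locally_constant (fun s => L s w : R);
  infil_one : L 1%g = @series_one X R;
  infil_mul : forall s t, L (s * t)%g = series_mul (L s) (L t);
  infil_nil : forall s, L s [::] = 1 :> R;
  infil_prod : forall s u v, (L s u : R) * (L s v : R) = infil_sum (L s) u v }.

Lemma infil_sum_one u v : infil_sum (@series_one X R) u v =
  (u == [::])%:R * (v == [::])%:R.
Proof.
case: u => [|a u]; first by rewrite infil_sum0l mul1r.
rewrite mul0r /infil_sum big_seq big1 // => w /infiltration_neq_nil/eqP.
by move=> wn; rewrite /series_one (negPf (wn _)).
Qed.

(** If both words are nonempty, only the merging of [x] with [x] contributes to the left side. *)
Lemma infil_sum_var x u v (f := series_add (@series_one X R) (series_var R x)) :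
  infil_sum f u v = (f u : R) * (f v : R).
Proof.
have f0 : f [::] = 1 :> R by rewrite /f /series_add /series_one /series_var addr0.
have fa a : series_shift a f = (fun w => (a == x)%:R * (w == [::])%:R).
  apply/funext => w; rewrite /series_shift /f /series_add /series_one /series_var.
  by rewrite add0r eqseq_cons -mulnb natrM.
have fac a w : series_shift a f w = (a == x)%:R * (@series_one X R w : R) by rewrite fa.
have shift_sum a u1 v1 : infil_sum (series_shift a f) u1 v1 =
    (a == x)%:R * ((u1 == [::])%:R * (v1 == [::])%:R).
  by rewrite -infil_sum_one /infil_sum mulr_sumr; apply: eq_bigr => w _; rewrite fac.
case: u => [|a u]; first by rewrite infil_sum0l f0 mul1r.
case: v => [|b v]; first by rewrite infil_sum0r f0 mulr1.
rewrite infil_sum_cons !shift_sum !mulr0 !mul0r mulr0 !add0r.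
rewrite -[f (a :: u)]/(series_shift a f u) -[f (b :: v)]/(series_shift b f v).
rewrite !fa; have [->|ab] := eqVneq a b.
  by case: (b == x); rewrite ?mul0r ?mul1r.
case: (eqVneq a x) => [ax|]; last by rewrite !mul0r.
by rewrite -ax [b == a]eq_sym (negPf ab) !mul0r mulr0.
Qed.

Lemma group_like_mul (f g : series X R) :
  (forall u v, (f u : R) * (f v : R) = infil_sum f u v) ->
  (forall u v, (g u : R) * (g v : R) = infil_sum g u v) ->
  forall u v, (series_mul f g u : R) * (series_mul f g v : R) =
    infil_sum (series_mul f g) u v.
Proof.
move=> fE gE u v; rewrite infil_sum_series_mul /series_mul mulr_suml.
apply: eq_bigr => k _; rewrite mulr_sumr; apply: eq_bigr => l _.
by rewrite -fE -gE; ring.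
Qed.

(* Induction on [size u + size v]: comparing the two expansions of the relation
   for [f g = 1], all terms but the one with [g] evaluated at [(u, v)] agree. *)
Lemma group_like_inv (f g : series X R) :
  series_mul f g = @series_one X R -> f [::] = 1 :> R ->
  (forall u v, (f u : R) * (f v : R) = infil_sum f u v) ->
  forall u v, (g u : R) * (g v : R) = infil_sum g u v.
Proof.
move=> fg f0 fE u v; have [n] := ubnP (size u + size v).
elim: n u v => // n IH u v; rewrite ltnS => uvn.
have : (series_mul f g u : R) * (series_mul f g v : R) = infil_conv f g u v.
  by rewrite -infil_sum_series_mul fg infil_sum_one.
rewrite /series_mul mulr_suml /infil_conv.
under eq_bigr do rewrite mulr_sumr.
rewrite big_ord_recl [RHS]big_ord_recl big_ord_recl [X in _ = X + _]big_ord_recl.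
rewrite /= !take0 !drop0 -fE f0 !mul1r -!addrA => /eqP.
rewrite (_ : \sum_(i < size v) _ + _ = \sum_(i < size v)
   infil_sum f [::] (take (bump 0 i) v) * infil_sum g u (drop (bump 0 i) v) +
   \sum_(i < size u) \sum_(l < (size v).+1)
     infil_sum f (take (bump 0 i) u) (take l v) *
     infil_sum g (drop (bump 0 i) u) (drop l v)).
  by move/eqP/addIr.
congr (_ + _).
  apply: eq_bigr => l _; rewrite -fE -IH ?f0 /=; first by rewrite !mul1r; ring.
  by have := ltn_ord l; rewrite size_drop /bump; lia.
apply: eq_bigr => k _; apply: eq_bigr => l _; rewrite -fE -IH; first by ring.
by have := ltn_ord k; rewrite !size_drop /bump; lia.
Qed.

(* [magnus] is defined by [xget]: were there no Magnus map, it would be the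
   constant series 1, which satisfies the same relations, so that the existence
   of the Magnus map is not needed. *)
Lemma magnus_infiltrative (iota : X -> S) : free_profinite iota ->
  infiltrative (magnus R iota).
Proof.
move=> [_ gen _]; rewrite /magnus; case: xgetP => [L _ [Lc L1 LM Lx]|_]; last first.
  have one0 : (@series_one X R) [::] = 1 :> R by [].
  have oneM : series_mul (@series_one X R) (@series_one X R) = @series_one X R.
    apply/funext => -[|a w]; rewrite [LHS]/=.
      by rewrite series_mul_nil mulr1.
    rewrite series_mul_cons mulr0 add0r /series_mul big1 // => k _.
    by rewrite /series_shift /series_one /= mul0r.
  by split => // [w s|s u v]; [exact: filterE|rewrite infil_sum_one].
have Llc w : locally_constant (fun s => L s w : R).
  apply/continuous_discreteP => s.
  have cw := @proj_continuous _ (fun=> discrete_topology R) w (L s).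
  exact: (cvg_comp _ _ (Lc s) cw).
(* [setT] is the closed subgroup generated by the basis, so an identity on [S] follows once its
   solutions form a closed subgroup containing the basis. *)
have closedP (P : S -> Prop) : (forall s, P s) = (setT `<=` [set s | P s]).
  by apply/propext; split => [H s _|H s]; [exact: H|exact: (H s)].
have Lnil s : L s [::] = 1 :> R.
  move: s; rewrite closedP -gen; apply: closed_gen_sub.
  - exact: (closed_locally_constant (P := fun r => r = 1) (Llc [::])).
  - split => [|s t /= s1 t1|s /= s1]; first by rewrite /= L1.
      by rewrite LM series_mul_nil s1 t1 mulr1.
    by have := congr1 (fun f => f [::] : R) (LM s s^-1%g);
      rewrite mulgV L1 series_mul_nil s1 mul1r => <-.
  - by move=> _ [x _ <-] /=; rewrite Lx /series_add /series_one /series_var addr0.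
split => // s u v; move: s u v; rewrite closedP -gen; apply: closed_gen_sub.
- have -> : [set s | forall u v, (L s u : R) * (L s v : R) = infil_sum (L s) u v] =
    \bigcap_(u in setT) \bigcap_(v in setT)
      [set s | (L s u : R) * (L s v : R) = infil_sum (L s) u v].
    by apply/seteqP; split => [s sE u _ v _|s sE u v]; [exact: sE|exact: (sE u _ v)].
  apply: closed_bigI => u _; apply: closed_bigI => v _.
  apply: (closed_locally_constant
    (f := fun s => ((L s u : R) * (L s v : R), infil_sum (L s) u v))
    (P := fun ab => ab.1 = ab.2)).
  apply: locally_constant_pair; first exact: locally_constant_op.
  by apply: locally_constant_sum => w.
- split => [u v /=|s t /= sE tE u v|s /= sE].
  + by rewrite L1 infil_sum_one.
  + by rewrite LM; exact: group_like_mul.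
  + by apply: (group_like_inv (f := L s)) => //; rewrite -LM mulgV.
- by move=> _ [x _ <-] /= u v; rewrite Lx infil_sum_var.
Qed.

End Infiltrative.

(** * Magnus coefficients on the Zassenhaus filtration *)

Lemma jindex_le p n m m' : prime p -> (0 < m <= m')%N ->
  (jindex p n m' <= jindex p n m)%N.
Proof.
move=> p_pr /andP[m0 mm']; have [_] := jindexP n p_pr (leq_trans m0 mm').
apply; have [nm _] := jindexP n p_pr m0.
by apply: leq_trans nm _; rewrite leq_mul2r mm' orbT.
Qed.

(** From [l * 'C(p^a, l) = p^a * 'C(p^a - 1, l - 1)], the valuation [c] of the binomial coefficient
    and the valuation of [l] add up to at least [a]. Hence [n <= k p^a <= k l p^c <= m p^c], and
    [c >= j_n(m)] by minimality. *)
Lemma dvdn_bin_ppow p n a k l m : prime p -> (0 < l)%N -> (0 < k)%N ->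
  (n <= k * p ^ a)%N -> (l * k <= m)%N ->
  (p ^ jindex p n m %| 'C(p ^ a, l))%N.
Proof.
move=> p_pr l0 k0 nk lkm; have p0 := prime_gt0 p_pr.
have [pl|lp] := ltnP (p ^ a) l; first by rewrite bin_small.
have C0 : (0 < 'C(p ^ a, l))%N by rewrite bin_gt0.
have m0 : (0 < m)%N by apply: leq_trans lkm; rewrite muln_gt0 l0.
rewrite pfactor_dvdn //; set c := logn p 'C(p ^ a, l).
have alc : (a <= logn p l + c)%N.
  rewrite /c -lognM // -pfactor_dvdn ?muln_gt0 ?l0 //.
  case: l l0 {lkm lp C0 c} => // l _.
  rewrite -[X in 'C(X, _)]prednK ?expn_gt0 ?p0 // -mul_bin_diag.
  by rewrite prednK ?expn_gt0 ?p0 // dvdn_mulr.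
have [_] := jindexP n p_pr m0; apply.
apply: leq_trans nk _; apply: leq_trans (_ : k * (l * p ^ c) <= _)%N; last first.
  by rewrite mulnA [(k * l)%N]mulnC leq_mul2r lkm orbT.
rewrite leq_mul2l; apply/orP; right.
apply: leq_trans (_ : p ^ (logn p l + c) <= _)%N.
  by rewrite leq_exp2l // prime_gt1.
by rewrite expnD leq_mul2r dvdn_leq ?orbT // pfactor_dvdnn.
Qed.

Section MagnusFiltration.
Variables (X : choiceType) (R : finComUnitRingType) (S : profiniteGroupType).
Variables (L : S -> series X R).
Hypothesis LI : infiltrative L.
Implicit Types (w : seq X) (s t : S).

Local Notation "'e[' w ] s" := (L s w : R) (at level 10, w at level 200,
  s at level 9, format "'e[' w ]  s").

Lemma series_mul_ends (f g : series X R) w : w <> [::] ->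
  series_mul f g w = (f [::] : R) * (g w : R) + (f w : R) * (g [::] : R) +
    \sum_(k < (size w).-1) (f (take k.+1 w) : R) * (g (drop k.+1 w) : R) :> R.
Proof.
case: w => // x w _; rewrite /series_mul big_ord_recl big_ord_recr /=.
by rewrite take_size drop_size addrAC -addrA addrA.
Qed.

Lemma coef_mul_ends w s t : w <> [::] ->
  e[w] (s * t)%g = e[w] s + e[w] t +
    \sum_(k < (size w).-1) e[take k.+1 w] s * e[drop k.+1 w] t.
Proof.
move=> w0; rewrite (infil_mul LI) series_mul_ends // !(infil_nil LI).
by rewrite mul1r mulr1 [e[w] t + _]addrC.
Qed.

Lemma coef_one w : w <> [::] -> e[w] 1%g = 0.
Proof. by move=> /eqP/negPf w0; rewrite (infil_one LI) /series_one w0. Qed.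

Lemma size_take_inner w (k : 'I_(size w).-1) : size (take k.+1 w) = k.+1.
Proof. by rewrite size_takel //; have := ltn_ord k; lia. Qed.

Lemma take_inner_neq0 w (k : 'I_(size w).-1) : take k.+1 w <> [::].
Proof. by move/(congr1 size); rewrite size_take_inner. Qed.

Lemma drop_inner_neq0 w (k : 'I_(size w).-1) : drop k.+1 w <> [::].
Proof. by move/(congr1 size); rewrite size_drop /=; have := ltn_ord k; lia. Qed.

Section IdealFiltration.
Variable J : nat -> R -> Prop.
Hypothesis J0 : forall m, J m 0.
Hypothesis JD : forall m a b, J m a -> J m b -> J m (a + b).
Hypothesis JM : forall m a b, J m a -> J m (a * b).
Hypothesis JS : forall m m' a, (0 < m <= m')%N -> J m a -> J m' a.

(** Common frame for two cases: vanishing at short words on the lower central series, and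
    divisibility by [p ^ j_n(m)] on [S_(n,p)]. [J m] is an ideal that grows with [m]. *)
Definition coef_filtered : set S :=
  [set s | forall w, w <> [::] -> J (size w) (e[w] s)].

Lemma closed_coef_filtered : closed coef_filtered.
Proof.
have -> : coef_filtered =
    \bigcap_(w in [set w | w <> [::]]) [set s | J (size w) (e[w] s)] by [].
apply: closed_bigI => w _.
exact: (closed_locally_constant (P := J (size w)) (infil_continuous LI w)).
Qed.

(** Each mixed term in the coefficient of [s t] contains a coefficient of [s] at a proper prefix, so
    it lies in [J] for arbitrary [t]. The identity [s s^-1 = 1] can therefore be solved for the
    inverse without induction on the word. *)
Lemma coef_filtered_subgroup : is_subgroup coef_filtered.
Proof.
have JN m a : J m a -> J m (- a) by move=> Ja; rewrite -mulrN1; exact: JM.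
have Jinner s w t : w <> [::] -> coef_filtered s -> J (size w)
    (\sum_(k < (size w).-1) e[take k.+1 w] s * e[drop k.+1 w] t).
  move=> w0 Hs; apply: (big_ind (J (size w))) => [//||k _]; first exact: JD.
  apply: JM; apply: JS (Hs _ (@take_inner_neq0 w k)).
  by rewrite size_take_inner /=; have := ltn_ord k; lia.
split=> [w w0|s t Hs Ht w w0|s Hs w w0].
- by rewrite coef_one.
- rewrite coef_mul_ends //; apply: JD; last exact: Jinner.
  by apply: JD; [exact: Hs|exact: Ht].
- have := coef_mul_ends s s^-1%g w0; rewrite mulgV coef_one // => /esym/eqP.
  rewrite addrAC addr_eq0 => /eqP E; rewrite -[e[w] _]opprK -E.
  by apply/JN/JD; [exact: Hs|exact: Jinner].
Qed.

Lemma closed_gen_coef_filtered (A : set S) :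
  A `<=` coef_filtered -> closed_gen A `<=` coef_filtered.
Proof.
exact: closed_gen_sub closed_coef_filtered coef_filtered_subgroup.
Qed.

End IdealFiltration.

(** For [b] in the previous term of the series, the mixed terms of [a b] and [b a] vanish in the
    lengths concerned, so their coefficients agree. Then [a b = b a [a, b]] and induction on the
    length kill those of the commutator. *)
Lemma lower_central_coef k s w : lower_central k s ->
  w <> [::] -> (size w < k)%N -> e[w] s = 0.
Proof.
rewrite /lower_central; case: k => // k /=.
elim: k s w => [|k IH] s w /=; first by case: w.
pose J m (a : R) := (m < k.+2)%N -> a = 0.
move=> Hs w0 wk; apply: (_ : coef_filtered J s) => //; move: s Hs {w w0 wk}.
apply: closed_gen_coef_filtered => //.
- by move=> m a b Ja Jb mk; rewrite Ja // Jb // addr0.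
- by move=> m a b Ja mk; rewrite Ja // mul0r.
- by move=> m m' a /andP[_ mm'] Ja mk; apply: Ja; exact: leq_ltn_trans mk.
move=> _ [a _ [b Hb <-]] w.
have [m] := ubnP (size w); elim: m w => // m IHm w; rewrite ltnS => wm w0 wk.
have abE : e[w] (a * b)%g = e[w] a + e[w] b.
  rewrite coef_mul_ends // big1 ?addr0 // => i _.
  rewrite (IH _ _ Hb) ?mulr0 //; first exact: drop_inner_neq0.
  by rewrite size_drop; have := ltn_ord i; lia.
have baE : e[w] (b * a)%g = e[w] b + e[w] a.
  rewrite coef_mul_ends // big1 ?addr0 // => i _.
  rewrite (IH _ _ Hb) ?mul0r //; first exact: take_inner_neq0.
  by rewrite size_take_inner; have := ltn_ord i; lia.
have : e[w] (b * a * [~ a, b])%g = e[w] (b * a)%g + e[w] [~ a, b]%g.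
  rewrite coef_mul_ends // big1 ?addr0 // => i _.
  rewrite (IHm (drop i.+1 w)) ?mulr0 //; last 2 first.
  - exact: drop_inner_neq0.
  - by rewrite size_drop; lia.
  - by rewrite size_drop; have := ltn_ord i; lia.
rewrite -commgC abE baE [e[w] b + _]addrC -[LHS]addr0.
by move/addrI.
Qed.

Definition magnus_mx w s : 'M[R]_((size w).+1) :=
  \matrix_(k < (size w).+1, l < (size w).+1)
    if (k <= l)%N then e[drop k (take l w)] s else 0.

Lemma magnus_mx_unitriangular w s : unitriangular (magnus_mx w s).
Proof.
apply/unitriangularP => k l lk; rewrite mxE.
case: leqP => [kl|]; last by case: eqP => // ->; rewrite ltnn.
have -> : k = l by apply: val_inj; apply/eqP; rewrite eqn_leq kl.
rewrite eqxx drop_oversize ?(infil_nil LI) // size_takel //.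
by rewrite -ltnS.
Qed.

Lemma magnus_mx1 w : magnus_mx w 1%g = 1%:M.
Proof.
have /unitriangularP U := magnus_mx_unitriangular w 1%g.
apply/matrixP => k l; have [lk|kl] := leqP l k; first by rewrite U // mxE.
rewrite !mxE ltnW // coef_one; last first.
  move/(congr1 size); rewrite size_drop size_takel /=; last by rewrite -ltnS.
  by lia.
by case: eqP kl => // ->; rewrite ltnn.
Qed.

Lemma magnus_mxM w s t :
  magnus_mx w (s * t)%g = magnus_mx w s *m magnus_mx w t.
Proof.
apply/matrixP => k l; rewrite !mxE.
under eq_bigr do rewrite !mxE.
have [lw kw] : (l <= size w)%N /\ (k <= size w)%N by split; rewrite -ltnS.
case: leqP => [kl|lk]; last first.
  rewrite big1 // => i _; case: leqP => ki; last by rewrite mul0r.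
  by rewrite ifF ?mulr0 //; lia.
(* The index [i] cuts the subword from [k] to [l]; terms outside this range vanish, and the others
   form the product of series. *)
pose G i := (if (k <= i)%N then e[drop k (take i w)] s else 0) *
  (if (i <= l)%N then e[drop i (take l w)] t else 0).
rewrite -(big_mkord xpredT G) (@big_cat_nat _ _ _ k) //=; last exact: leq_trans (leqW kw).
rewrite big_nat big1 ?add0r => [|i /andP[_ ik]]; last first.
  by rewrite /G leqNgt ik mul0r.
rewrite (@big_cat_nat _ _ _ l.+1) //= ?ltnS; last exact: leqW.
rewrite [X in _ + X]big_nat [X in _ + X]big1 ?addr0 => [|i /andP[li _]];
    last first.
  by rewrite /G [(i <= l)%N]leqNgt li mulr0.
rewrite -[X in index_iota X _]add0n big_addn (infil_mul LI) /series_mul.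
rewrite size_drop size_takel // subSn // big_mkord; apply: eq_bigr => i _.
have il : (i + k <= l)%N by have := ltn_ord i; lia.
rewrite /G leq_addl il drop_drop; congr (e[_] s * _).
by rewrite take_drop take_takel.
Qed.

Lemma magnus_mxX w s N : magnus_mx w (s ^+ N)%g = magnus_mx w s ^+ N.
Proof.
elim: N => [|N IH]; first by rewrite magnus_mx1.
by rewrite expgS magnus_mxM IH exprS.
Qed.

Lemma magnus_mx_corner w s : magnus_mx w s ord0 ord_max = e[w] s.
Proof. by rewrite mxE /= drop0 take_size. Qed.

(** [M] moves at least [K] places to the right, so [M ^+ i] moves at least [i * K]. *)
Lemma superdiagonal_expr m (M : 'M[R]_m.+1) K i (k l : 'I_m.+1) :
  (forall a b : 'I_m.+1, (b < a + K)%N -> M a b = 0) ->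
  (l < k + i * K)%N -> (M ^+ i) k l = 0.
Proof.
move=> M0; elim: i k l => [|i IH] k l kl.
  rewrite mxE; case: eqP kl => // ->; rewrite mul0n addn0 ltnn //.
rewrite exprS mxE big1 // => a _.
have [ak|ka] := ltnP a (k + K); first by rewrite M0 ?mul0r.
by rewrite IH ?mulr0 //; rewrite mulSn in kl; lia.
Qed.

(** The matrix of [s] is [1 + M] with [M] zero below the [k]-th superdiagonal. In the binomial
    expansion of its [p^a]-th power, the corner entry of [M ^+ i] vanishes if [i k > |w|];
    otherwise, for [i > 0], the binomial coefficient is divisible by [p ^ j_n(|w|)]. *)
Lemma lower_central_ppow_coef p n k a s w : prime p -> (0 < k)%N ->
  (n <= k * p ^ a)%N -> lower_central k s -> w <> [::] ->
  exists r : R, e[w] (s ^+ (p ^ a))%g = r *+ (p ^ jindex p n (size w)).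
Proof.
move=> p_pr k0 nk Hs w0; set q := jindex _ _ _.
pose M := magnus_mx w s - 1.
have ME i l : M i l = magnus_mx w s i l - (i == l)%:R.
  by rewrite /M mxE; congr (_ + _); rewrite !mxE.
have M0 (i l : 'I_(size w).+1) : (l < i + k)%N -> M i l = 0.
  move=> lik; have /unitriangularP U := magnus_mx_unitriangular w s.
  have [li|il] := leqP l i; first by rewrite ME U // subrr.
  rewrite ME mxE ltnW // (lower_central_coef Hs).
  - by case: eqP il => [->|]; rewrite ?ltnn ?subrr.
  - move/(congr1 size); rewrite size_drop size_takel /=; last by rewrite -ltnS.
    by lia.
  - by rewrite size_drop size_takel; [lia|rewrite -ltnS].
rewrite -magnus_mx_corner magnus_mxX -[magnus_mx w s](subrK 1) exprD1n summxE.
apply: (big_ind (fun x : R => exists r, x = r *+ p ^ q)).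
- by exists 0; rewrite mul0rn.
- by move=> _ _ [r ->] [r' ->]; exists (r + r'); rewrite mulrnDl.
move=> i _; have [ik|ik] := ltnP (size w) (i * k).
  exists 0; rewrite mul0rn mulmxnE -/M (superdiagonal_expr M0) ?mul0rn //.
rewrite mulmxnE; have [i0|i0] := posnP i.
  (* The term [i = 0] is the corner entry of the identity, zero as [w] is nonempty. *)
  exists 0; rewrite i0 expr0 mxE.
  have -> : (ord0 == ord_max :> 'I_(size w).+1) = false by case: w w0 {q M M0 ME ik}.
  by rewrite !mul0rn.
have /dvdnP[d ->] := dvdn_bin_ppow p_pr i0 k0 nk ik.
exists (((magnus_mx w s - 1) ^+ i *+ d : 'M[R]_((size w).+1)) ord0 ord_max).
by rewrite mulmxnE mulrnA.
Qed.

Lemma zassenhaus_coef p n s w : prime p -> zassenhaus S p n s -> w <> [::] ->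
  exists r : R, e[w] s = r *+ (p ^ jindex p n (size w)).
Proof.
move=> p_pr Hs w0.
pose J m (a : R) := exists r : R, a = r *+ (p ^ jindex p n m).
apply: (_ : coef_filtered J s) => //; move: s Hs {w w0}.
apply: closed_gen_coef_filtered.
- by move=> m; exists 0; rewrite mul0rn.
- by move=> m _ _ [r ->] [r' ->]; exists (r + r'); rewrite mulrnDl.
- by move=> m _ b [r ->]; exists (r * b); rewrite mulrnAl.
- move=> m m' _ mm' [r ->].
  exists (r *+ p ^ (jindex p n m - jindex p n m')).
  by rewrite -mulrnA -expnD subnK // jindex_le.
move=> _ [k [a [x [k0 nk Hx ->]]]] w w0.
exact: (lower_central_ppow_coef p_pr k0 nk Hx).
Qed.

Definition magnus_rep w s : UU R (size w) := UU_of_mx (magnus_mx w s).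

Lemma mx_of_magnus_rep w s : mx_of_UU (magnus_rep w s) = magnus_mx w s.
Proof. exact: UU_of_mxK (magnus_mx_unitriangular w s). Qed.

Lemma magnus_repM w s t :
  magnus_rep w (s * t)%g = (magnus_rep w s * magnus_rep w t)%g.
Proof.
by apply: mx_of_UU_inj; rewrite mx_of_UUM !mx_of_magnus_rep magnus_mxM.
Qed.

Lemma locally_constant_magnus_rep w : locally_constant (magnus_rep w).
Proof.
move=> x; apply: filterS (_ : \forall y \near x, forall k l : 'I_(size w).+1,
    magnus_mx w y k l = magnus_mx w x k l) => [y H|].
  by apply: mx_of_UU_inj; rewrite !mx_of_magnus_rep; apply/matrixP => k l.
apply: filter_forall => k; apply: filter_forall => l.
apply: filterS (infil_continuous LI (drop k (take l w)) x) => y H.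
by rewrite !mxE H.
Qed.

End MagnusFiltration.

(** * Extension classes of unitriangular groups *)

Section PowerEmbedding.
Variables (p j : nat).
Hypothesis p_pr : prime p.

Local Notation R := 'Z_(p ^ j.+1).

(** Identifies Z/p with the multiples of [p^j] in Z/p^(j+1); its inverse there is the formula in
    [corner_coord]. *)
Definition Zp_embed (z : 'Z_p) : R := (z * p ^ j)%:R.

Lemma ppow_gt1 : (1 < p ^ j.+1)%N.
Proof. by rewrite -[1%N](expn0 p) ltn_exp2l // prime_gt1. Qed.

Lemma Zp_embed_nat k : Zp_embed k%:R = (k * p ^ j)%:R.
Proof.
apply: ord_inj; rewrite /Zp_embed !val_Zp_nat ?ppow_gt1 ?prime_gt1 //.
by rewrite expnS muln_modl modn_mod.
Qed.

Lemma Zp_embedD : {morph Zp_embed : a b / a + b}.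
Proof.
move=> a b; rewrite -[a]natr_Zp -[b]natr_Zp -natrD !Zp_embed_nat.
by rewrite mulnDl natrD.
Qed.

Lemma Zp_embed0 : Zp_embed 0 = 0.
Proof. by rewrite -[0]/(0%:R) Zp_embed_nat mul0n. Qed.

Lemma Zp_embedN : {morph Zp_embed : a / - a}.
Proof.
move=> a; apply/eqP; rewrite -addr_eq0 -Zp_embedD addNr; exact/eqP/Zp_embed0.
Qed.

Lemma val_Zp_embed z : Zp_embed z = (z * p ^ j)%N :> nat.
Proof.
rewrite val_Zp_nat ?ppow_gt1 // modn_small // expnS ltn_pmul2r.
  by rewrite -[X in (_ < X)%N]Zp_cast ?prime_gt1 // ltn_ord.
by rewrite expn_gt0 prime_gt0.
Qed.

Lemma Zp_embedK : cancel Zp_embed (fun r : R => (r %/ p ^ j)%:R : 'Z_p).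
Proof.
move=> z; rewrite val_Zp_embed mulnK ?natr_Zp //.
by rewrite expn_gt0 prime_gt0.
Qed.

Lemma Zp_embed_inj : injective Zp_embed.
Proof. exact: can_inj Zp_embedK. Qed.

Lemma Zp_embed_mulrn (r : R) : r *+ p ^ j = Zp_embed (r : nat)%:R.
Proof. by rewrite Zp_embed_nat natrM mulr_natr natr_Zp. Qed.

Lemma ppow_mulrn0 (r : R) k : (j < k)%N -> r *+ p ^ k = 0.
Proof.
move=> jk; rewrite -mulr_natr (_ : (p ^ k)%:R = 0 :> R) ?mulr0 //.
apply: ord_inj; rewrite val_Zp_nat ?ppow_gt1 //.
by apply/eqP; rewrite -/(dvdn _ _) dvdn_exp2l.
Qed.

End PowerEmbedding.

Lemma locally_constant_continuous (T T' : topologicalType) (A : Type)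
    (f : T' -> A) (g : T -> T') :
  continuous g -> locally_constant f -> locally_constant (f \o g).
Proof. by move=> cg cf x; exact: (cg x _ (cf (g x))). Qed.

Lemma locally_constant_prod (T T' : topologicalType) (A B C : Type)
    (h : A -> B -> C) (f : T -> A) (g : T' -> B) :
  locally_constant f -> locally_constant g ->
  locally_constant (fun xy : T * T' => h (f xy.1) (g xy.2)).
Proof.
move=> cf cg; apply: locally_constant_op.
  by apply: locally_constant_continuous cf => x; exact: cvg_fst.
by apply: locally_constant_continuous cg => x; exact: cvg_snd.
Qed.

Lemma locally_constant_discrete (A : choiceType) (B : Type)
    (f : discrete_topology A -> B) : locally_constant f.
Proof.
by move=> x; apply: (@filterS _ (nbhs x) _ [set x]) (discrete_set1 x) => _ ->.
Qed.

Section Quotient.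
Variables (G : topGroupType) (N : normal_subgroup G).
Local Notation Q := (quotient_group N).

Lemma locally_constant_quotient (A : Type) (f : Q -> A) :
  locally_constant (f \o \pi_Q) -> locally_constant f.
Proof.
move=> cf x; pose B := [set s | f (\pi_Q s) = f x].
have oB : open B.
  by rewrite openE => s /= fs; apply: filterS (cf s) => t /= ft; rewrite /B /= ft.
have QB : open (\pi_Q @` B) by exact: quotient_pi_open.
apply: filterS (open_nbhs_nbhs (conj QB _)).
  by move=> _ [s Bs <-].
by exists (repr x); rewrite /B /= reprK.
Qed.

Lemma quotient_mulE (x y : G) : (\pi_Q x * \pi_Q y)%g = \pi_Q (x * y)%g.
Proof. exact: pi_mulg. Qed.

Lemma mem_repr_pi (x : G) : N (x^-1 * repr (\pi_Q x))%g.
Proof. by apply/eq_cosetP; rewrite reprK. Qed.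

Lemma mem_repr_mul (a b : Q) : N (repr a * repr b * (repr (a * b)%g)^-1)%g.
Proof.
set u := repr (a * b)%g; set v := (repr a * repr b)%g.
have : N (u^-1 * v)%g.
  by apply/eq_cosetP; rewrite /u /v -quotient_mulE !reprK.
move/(@normal_conj _ N _ u^-1%g); rewrite /conjg invgK !mulgA mulgV mul1g.
by [].
Qed.

End Quotient.

Section CornerExtension.
Variables (p m c : nat) (R : finComUnitRingType).
Variables (emb : 'Z_p -> R) (coord : R -> 'Z_p).
Hypothesis m_gt0 : (0 < m)%N.
Hypothesis embD : {morph emb : a b / a + b}.
Hypothesis embK : cancel emb coord.
Hypothesis emb_mulrn : forall r, exists z, r *+ c = emb z.
Hypothesis mulrn_emb : forall z, exists a : nat, emb z = (a * c)%:R.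

Local Notation U := (UU R m).
Local Notation C := (corner R m c).
Local Notation Q := (quotient_group C).
Local Notation E := (delta_mx ord0 ord_max : 'M[R]_m.+1).

(** [emb] and [coord] stand for [Zp_embed] and division by [p^j]. By the section hypotheses [emb]
    maps Z/p onto [c R], so the corner is [1 + emb(Z/p) E]. *)
Definition corner_theta (A : U) : 'Z_p := coord (mx_of_UU A ord0 ord_max).
Local Notation theta := corner_theta.

Lemma ord0_neq_max : (ord0 == ord_max :> 'I_m.+1) = false.
Proof. by apply/eqP => /(congr1 val) /= m0; move: m_gt0; rewrite -m0. Qed.

Lemma corner_entry (r : R) : (1%:M + r *: E) ord0 ord_max = r.
Proof. by rewrite !mxE ord0_neq_max !eqxx mulr1 add0r. Qed.

Lemma theta_corner (A : U) z : mx_of_UU A = 1%:M + emb z *: E -> theta A = z.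
Proof. by move=> AE; rewrite /corner_theta AE corner_entry embK. Qed.

Lemma cornerP (A : U) : C A <-> mx_of_UU A = 1%:M + emb (theta A) *: E.
Proof.
split=> [[a Aa]|AE].
  have [z zE] := emb_mulrn a%:~R.
  have Az : mx_of_UU A = 1%:M + emb z *: E by rewrite -zE -mulr_natl.
  by rewrite (theta_corner Az).
have [a aE] := mulrn_emb (theta A).
by exists (a : int); rewrite AE aE /corner_mx natrM mulrC.
Qed.

Lemma theta_cornerM (A B : U) : C A -> C B ->
  theta (A * B)%g = theta A + theta B.
Proof.
move=> /cornerP AE /cornerP BE; apply: theta_corner.
rewrite mx_of_UUM AE mulmxDl mul1mx -scalemxAl UU_delta {1}BE.
by rewrite embD scalerDl -addrA [emb (theta A) *: _ + _]addrC.
Qed.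

Lemma mulUU_corner (A B : U) : C B ->
  mx_of_UU (A * B)%g = mx_of_UU A + emb (theta B) *: E.
Proof.
move=> /cornerP BE.
by rewrite mx_of_UUM {1}BE mulmxDr mulmx1 -scalemxAr delta_UU.
Qed.

Lemma mulmx_corner (A B : 'M[R]_m.+1) a b :
  A *m E = E -> E *m B = E ->
  ((A + a *: E) *m (B + b *: E)) ord0 ord_max = (A *m B) ord0 ord_max + a + b.
Proof.
move=> AE EB; rewrite mulmxDl !mulmxDr -!scalemxAl -!scalemxAr AE EB.
rewrite mul_delta_mx_0 ?scaler0 ?addr0 1?eq_sym ?ord0_neq_max //.
by rewrite !mxE !eqxx !mulr1 addrAC.
Qed.

Definition section_cocycle (xy : Q * Q) : 'Z_p :=
  theta (repr xy.1 * repr xy.2 * (repr (xy.1 * xy.2)%g)^-1)%g.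

(** The products [repr x * repr y] and [repr (x * y)] differ by a factor [z] in the central corner,
    which adds [emb (theta z)] to the corner entry. *)
Lemma section_cocycleE x y : emb (section_cocycle (x, y)) =
  mx_of_UU (repr x * repr y)%g ord0 ord_max - mx_of_UU (repr (x * y)%g) ord0 ord_max.
Proof.
rewrite /section_cocycle /=; set z := (_ * _^-1)%g.
have Cz : C z by exact: mem_repr_mul.
have -> : (repr x * repr y = repr (x * y) * z)%g.
  by rewrite -(corner_central _ Cz) mulgKV.
by rewrite mulUU_corner // mxE addrAC subrr add0r !mxE !eqxx mulr1.
Qed.

Lemma section_cocycle_closed : section_cocycle \in @cocycle2 p Q.
Proof.
apply/asboolP; split.
  apply/continuous_discreteP.
  have idQ : locally_constant (@id Q).
    by apply: locally_constant_quotient; exact: locally_constant_discrete.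
  exact: (locally_constant_prod (fun x y => section_cocycle (x, y)) idQ idQ).
move=> x y t; pose z (a b : Q) := (repr a * repr b * (repr (a * b)%g)^-1)%g.
have Cz (a b : Q) : C (z a b) by exact: mem_repr_mul.
have zE a b : (z a b * repr (a * b) = repr a * repr b)%g by rewrite mulgKV.
(* After multiplication by [repr (x * y * t)] both sides become the product of the three
   representatives; on the right [z y t] moves by centrality. *)
have zz : (z x y * z (x * y) t = z y t * z x (y * t))%g.
  apply: (mulIg (repr (x * y * t)%g)).
  transitivity (repr x * repr y * repr t)%g.
    by rewrite -mulgA zE mulgA zE.
  rewrite -[(x * y * t)%g]mulgA -[RHS]mulgA zE [RHS]mulgA.
  by rewrite (corner_central _ (Cz y t)) -[RHS]mulgA zE mulgA.
have zc a b : theta (z a b) = section_cocycle (a, b) by [].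
have := congr1 theta zz; rewrite (theta_cornerM (Cz _ _) (Cz _ _)).
rewrite (theta_cornerM (Cz _ _) (Cz _ _)) !zc.
by move=> H; rewrite [X in X - _]addrAC -H addrK subrr.
Qed.

End CornerExtension.

Lemma class2E (p : nat) (G : topGroupType) (c : Z2 p G) :
  class2 (c : G * G -> 'Z_p) = \pi_{ideal_quot (B2 p G)} c.
Proof. by rewrite /class2 valKd. Qed.

(** Here [i] is the least integer with [n <= i p^k], so [j_n(i) <= k]; if [j_n(m) <= j_n(i)], then
    [n <= m p^k], against [m < i]. *)
Lemma JJ_jindex p n i m : prime p -> JJ p n i -> (0 < m < i)%N ->
  (jindex p n i < jindex p n m)%N.
Proof.
move=> p_pr [i0 _ [k ik]] /andP[m0 mi].
have ceilP d a : (0 < d)%N -> (ceil_div n d <= a)%N = (n <= a * d)%N.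
  move=> d0; rewrite /ceil_div -ltnS ltn_divLR // mulSn; lia.
have pk0 e : (0 < p ^ e)%N by rewrite expn_gt0 prime_gt0.
have [_ jk] := jindexP n p_pr i0; have [nm _] := jindexP n p_pr m0.
have ji : (jindex p n i <= k)%N by apply: jk; rewrite -ceilP // ik.
rewrite ltnNge; apply/negP => jmi.
have : (n <= m * p ^ k)%N.
  apply: leq_trans nm _; rewrite leq_mul2l leq_exp2l ?prime_gt1 //.
  by rewrite (leq_trans jmi) // orbT.
by rewrite -ceilP // -ik leqNgt mi.
Qed.

(** * Pullback along the Magnus representation *)

Section MagnusPullback.
Variables (p c : nat) (X : choiceType) (R : finComUnitRingType).
Variables (S : profiniteGroupType) (N : normal_subgroup S).
Variables (L : S -> series X R) (w : seq X).
Variables (emb : 'Z_p -> R) (coord : R -> 'Z_p).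
Hypothesis LI : infiltrative L.
Hypothesis w_gt0 : (0 < size w)%N.
Hypothesis embD : {morph emb : a b / a + b}.
Hypothesis embK : cancel emb coord.
Hypothesis emb_mulrn : forall r, exists z, r *+ c = emb z.
Hypothesis mulrn_emb : forall z, exists a : nat, emb z = (a * c)%:R.
Hypothesis coefN_lt : forall s v, N s -> v <> [::] -> (size v < size w)%N ->
  L s v = 0 :> R.
Hypothesis coefN_eq : forall s, N s -> exists r : R, L s w = r *+ c :> R.

Local Notation G := (quotient_group N).
Local Notation C := (corner R (size w) c).
Local Notation Q := (quotient_group C).
Local Notation E := (delta_mx ord0 ord_max : 'M[R]_((size w).+1)).
Local Notation rho := (magnus_rep L w).
Local Notation theta := (@corner_theta p (size w) R coord).

Definition magnus_rep_bar (x : G) : Q := \pi_Q (rho (repr x)).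
Local Notation rho_bar := magnus_rep_bar.

(** Entries above the diagonal other than the corner are coefficients at proper subwords of [w],
    which vanish on [N]. *)
Lemma magnus_rep_corner s : N s -> C (rho s).
Proof.
move=> Ns; have [r rE] := coefN_eq Ns; have [z zE] := emb_mulrn r.
have rhoE : mx_of_UU (rho s) = 1%:M + emb z *: E.
  rewrite (mx_of_magnus_rep LI) -zE -rE; apply/matrixP => k l.
  have /unitriangularP U := magnus_mx_unitriangular LI w s.
  have -> : (1%:M + (L s w : R) *: E) k l =
      (k == l)%:R + (L s w : R) * ((k == ord0) && (l == ord_max))%:R.
    by rewrite !mxE.
  have [lk|kl] := leqP l k.
    rewrite U // [X in _ + _ * X](_ : _ = 0) ?mulr0 ?addr0 //.
    case: andP => // -[/eqP k0 /eqP lm]; move: lk; rewrite k0 lm /=.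
    by rewrite leqNgt w_gt0.
  rewrite (_ : (k == l) = false) ?add0r; last first.
    by apply/eqP => kl'; rewrite kl' ltnn in kl.
  have [lw kw] : (l <= size w)%N /\ (k <= size w)%N by split; rewrite -ltnS.
  case: andP => [[/eqP -> /eqP ->]|kl0].
    by rewrite mulr1 (magnus_mx_corner L).
  rewrite mulr0 mxE ltnW // coefN_lt //.
    by move/(congr1 size); rewrite size_drop size_takel //=; lia.
  rewrite size_drop size_takel // ltn_neqAle leq_subLR.
  rewrite (leq_trans lw) ?leq_addl // andbT; apply/eqP => lkE; apply: kl0.
  by split; apply/eqP/val_inj => /=; lia.
by apply/(cornerP w_gt0 embK emb_mulrn mulrn_emb);
  rewrite (theta_corner w_gt0 embK rhoE).
Qed.

Lemma magnus_rep_bar_pi s : rho_bar (\pi_G s) = \pi_Q (rho s).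
Proof.
apply/eq_cosetP; set r := repr _.
have -> : rho s = (rho r * rho (r^-1 * s))%g by rewrite -(magnus_repM LI) mulVKg.
rewrite mulKg; apply: magnus_rep_corner; apply/eq_cosetP.
by rewrite /r reprK.
Qed.

Lemma magnus_rep_barM x y : rho_bar (x * y)%g = (rho_bar x * rho_bar y)%g.
Proof.
elim/quotW: x => s; elim/quotW: y => t.
by rewrite quotient_mulE !magnus_rep_bar_pi quotient_mulE (magnus_repM LI).
Qed.

Lemma locally_constant_magnus_rep_bar : locally_constant rho_bar.
Proof.
apply: locally_constant_quotient.
have -> : rho_bar \o \pi_G = \pi_Q \o rho.
  by apply/funext => s; exact: magnus_rep_bar_pi.
exact: (locally_constant_comp \pi_Q (locally_constant_magnus_rep LI w)).
Qed.

(* The connecting cochain [g] absorbs both the choice of representatives in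
   [UU] and the choice of a cocycle in the class [extension_class]. *)
Lemma pullback_extension_cocycle :
  exists (a : Z2 p G) (g : G -> 'Z_p),
  [/\ pullback2 rho_bar (extension_class C theta) = \pi_{ideal_quot (B2 p G)} a,
      locally_constant (fun x => emb (g x) + (L (repr x) w : R)) &
      forall x y, emb (a (x, y)) = emb (g x) + emb (g y) - emb (g (x * y)%g) +
        ((L (repr x * repr y)%g w : R) - (L (repr (x * y)%g) w : R))].
Proof.
pose c0 : Z2 p Q :=
  MkZ2 (section_cocycle_closed w_gt0 embD embK emb_mulrn mulrn_emb).
have gammaE : extension_class C theta = \pi_{ideal_quot (B2 p Q)} c0.
  exact: class2E c0.
set ga := extension_class C theta in gammaE *.
(* [pullback2] evaluates this representative of the class, which differs from the section cocycle
   [c0] by the coboundary of [f]. *)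
pose c1 : Z2 p Q := repr (ga : {ideal_quot (B2 p Q)}).
have : c1 - c0 \in B2 p Q.
  by rewrite Quotient.idealrBE; apply/eqP; rewrite /c1 reprK.
move=> /asboolP[f [/continuous_discreteP fc fE]].
have c1E x y : c1 (x, y) = c0 (x, y) + (f y - f (x * y)%g + f x).
  by rewrite -fE; have -> : (c1 - c0) (x, y) = c1 (x, y) - c0 (x, y) by []; ring.
have rho_lc := locally_constant_magnus_rep_bar.
have embN : {morph emb : a / - a}.
  have emb0 : emb 0 = 0 by apply: (addrI (emb 0)); rewrite -embD !addr0.
  by move=> a; apply/eqP; rewrite -addr_eq0 -embD addNr emb0.
have /asboolP[_ c1_closed] : (c1 : Q * Q -> 'Z_p) \in @cocycle2 p Q.
  exact: (valP c1).
have aP : (fun xy : G * G => c1 (rho_bar xy.1, rho_bar xy.2)) \in @cocycle2 p G.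
  apply/asboolP; split.
    apply/continuous_discreteP.
    exact: (locally_constant_prod (fun x y => c1 (x, y)) rho_lc rho_lc).
  by move=> x y t; rewrite /= !magnus_rep_barM c1_closed.
(* Corner discrepancy between [rho (repr x)] and the chosen representative of its class. *)
pose kap (x : G) := theta ((rho (repr x))^-1 * repr (rho_bar x))%g.
have rhoE x : mx_of_UU (repr (rho_bar x)) =
    magnus_mx L w (repr x) + emb (kap x) *: E.
  have Cx : C ((rho (repr x))^-1 * repr (rho_bar x))%g by exact: mem_repr_pi.
  rewrite -(mx_of_magnus_rep LI)
    -(mulUU_corner w_gt0 embK emb_mulrn mulrn_emb _ Cx).
  by rewrite mulVKg.
have tauE x : mx_of_UU (repr (rho_bar x)) ord0 ord_max =
    (L (repr x) w : R) + emb (kap x).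
  by rewrite rhoE mxE (magnus_mx_corner L) !mxE !eqxx mulr1.
exists (MkZ2 aP), (fun x => f (rho_bar x) + kap x); split.
- exact: (class2E (MkZ2 aP)).
(* The sum factors through [rho_bar]; its summands are not treated separately, as [repr] need not be
   continuous. *)
- have -> : (fun x => emb (f (rho_bar x) + kap x) + (L (repr x) w : R)) =
      (fun q => emb (f q) + mx_of_UU (repr q) ord0 ord_max) \o rho_bar.
    by apply/funext => x /=; rewrite tauE embD; ring.
  exact: locally_constant_comp.
move=> x y; rewrite [X in emb X](_ : _ = c1 (rho_bar x, rho_bar y)) //.
rewrite c1E !embD embN.
rewrite [emb (c0 _)](section_cocycleE w_gt0 embK emb_mulrn mulrn_emb).
rewrite mx_of_UUM (rhoE x) (rhoE y) mulmx_corner //; last 2 first.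
- by rewrite -(mx_of_magnus_rep LI) delta_UU.
- by rewrite -(mx_of_magnus_rep LI) UU_delta.
rewrite -(magnus_mxM LI) (magnus_mx_corner L) -magnus_rep_barM tauE; ring.
Qed.

End MagnusPullback.

(** * The shuffle relation *)

Section Alpha.
Variables (p n m : nat) (X : choiceType) (S : profiniteGroupType).
Variables (iota : X -> S).
Hypothesis p_pr : prime p.
Hypothesis iota_free : free_profinite iota.
Hypothesis m_JJ : JJ p n m.

Local Notation N := (zassenhaus S p n).
Local Notation G := (quotient_group N).
Local Notation j := (jindex p n m).
Local Notation R := ('Z_(p ^ j.+1) : finComUnitRingType).
Local Notation L := (magnus R iota).
Local Notation emb := (@Zp_embed p j).

Lemma magnus_zassenhaus0 s v : N s -> v <> [::] -> (size v < m)%N ->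
  L s v = 0 :> R.
Proof.
move=> Ns v0 vm.
have [r ->] := zassenhaus_coef (magnus_infiltrative R iota_free) p_pr Ns v0.
apply: ppow_mulrn0 => //; apply: JJ_jindex => //.
by rewrite vm andbT; case: v v0 {vm}.
Qed.

Lemma alpha_cocycle w : size w = m ->
  exists (a : Z2 p G) (g : G -> 'Z_p),
  [/\ alpha p n iota w = \pi_{ideal_quot (B2 p G)} a,
      locally_constant (fun x => emb (g x) + (L (repr x) w : R)) &
      forall x y, emb (a (x, y)) = emb (g x) + emb (g y) - emb (g (x * y)%g) +
        ((L (repr x * repr y)%g w : R) - (L (repr (x * y)%g) w : R))].
Proof.
move=> wm; have m0 : (0 < m)%N by case: m_JJ.
(* Replacing [m] by [size w] makes the coefficient ring literally the one in [alpha]. *)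
have coef0 := magnus_zassenhaus0; move: m0 coef0; rewrite -{}wm => w0 coef0.
have LI := magnus_infiltrative 'Z_(p ^ (jindex p n (size w)).+1) iota_free.
apply: (pullback_extension_cocycle (c := p ^ jindex p n (size w)) LI w0
  (Zp_embedD _ p_pr) (@Zp_embedK _ _ p_pr)).
- by move=> r; exists ((r : nat)%:R); exact: Zp_embed_mulrn.
- by move=> z; exists (z : nat).
- exact: coef0.
- by move=> s Ns; apply: (zassenhaus_coef LI p_pr Ns) => w0'; rewrite w0' in w0.
Qed.

(** Local constancy is carried along for [emb (g x)] plus the coefficients, since a single
    coefficient at length [m] need not descend to the quotient. *)
Lemma sum_alpha_cocycle (l : seq (seq X)) : (forall w, w \in l -> size w = m) ->
  exists (a : Z2 p G) (g : G -> 'Z_p),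
  [/\ \sum_(w <- l) alpha p n iota w = \pi_{ideal_quot (B2 p G)} a,
      locally_constant (fun x => emb (g x) + \sum_(w <- l) (L (repr x) w : R)) &
      forall x y, emb (a (x, y)) = emb (g x) + emb (g y) - emb (g (x * y)%g) +
        (\sum_(w <- l) (L (repr x * repr y)%g w : R)
         - \sum_(w <- l) (L (repr (x * y)%g) w : R))].
Proof.
have emb0 := Zp_embed0 j p_pr.
elim: l => [|w l IH] lm.
  exists 0, (fun=> 0); split; first by rewrite big_nil raddf0.
    by move=> x; apply: filterE => y; rewrite !big_nil.
  by move=> x y; rewrite !big_nil [X in emb X]/(0 : 'Z_p) emb0; ring.
have [|a [g [aE gc aL]]] := IH; first by move=> v vl; rewrite lm // inE vl orbT.
have [|b [h [bE hc bL]]] := @alpha_cocycle w; first by rewrite lm // inE eqxx.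
exists (b + a), (fun x => h x + g x); split.
- by rewrite big_cons bE aE raddfD.
- have -> : (fun x : G => emb (h x + g x) + \sum_(v <- w :: l) (L (repr x) v : R)) =
    (fun x => (emb (h x) + (L (repr x) w : R)) +
              (emb (g x) + \sum_(v <- l) (L (repr x) v : R))).
    by apply/funext => x; rewrite big_cons Zp_embedD //; ring.
  exact: locally_constant_op.
move=> x y; rewrite !big_cons.
have -> : (b + a) (x, y) = b (x, y) + a (x, y) by [].
by rewrite !Zp_embedD // aL bL; ring.
Qed.

Section Shuffle.
Variables u v : seq X.
Hypothesis uv_size : (size u + size v = m)%N.
Hypothesis u0 : u <> [::].
Hypothesis v0 : v <> [::].

Lemma coef_zassenhaus_mul w s t : (size w < m)%N -> N t ->
  L (s * t)%g w = L s w :> R.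
Proof.
have LI := magnus_infiltrative R iota_free.
move=> wm Nt; case: w wm => [|a w] wm; first by rewrite !(infil_nil LI).
rewrite (coef_mul_ends LI) // (magnus_zassenhaus0 Nt _ wm) // addr0.
rewrite big1 ?addr0 // => k _.
rewrite (magnus_zassenhaus0 Nt) ?mulr0 //; first exact: drop_inner_neq0.
by rewrite size_drop; apply: leq_ltn_trans (leq_subr _ _) wm.
Qed.

(* The infiltration relation expresses the shuffle sum through coefficients at
   shorter words. *)
Lemma shuffle_sum_zassenhaus s t : N t ->
  \sum_(w <- shuffles u v) (L (s * t)%g w : R) =
  \sum_(w <- shuffles u v) (L s w : R).
Proof.
have LI := magnus_infiltrative R iota_free.
have sumE r : \sum_(w <- shuffles u v) (L r w : R) = (L r u : R) * (L r v : R) -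
    \sum_(w <- infiltration u v | size w != m) (L r w : R).
  apply/eqP; rewrite eq_sym subr_eq (infil_prod LI) /infil_sum; apply/eqP.
  by rewrite (bigID (fun w => size w == m)) /shuffles big_filter uv_size.
move=> Nt; rewrite !sumE; congr (_ * _ - _).
(* Since [u] and [v] are nonempty, each is shorter than [m]. *)
- by apply: coef_zassenhaus_mul => //; rewrite -uv_size; case: v v0 => //= *; lia.
- by apply: coef_zassenhaus_mul => //; rewrite -uv_size; case: u u0 => //= *; lia.
rewrite big_seq_cond [RHS]big_seq_cond; apply: eq_bigr => w /andP[win wm].
apply: coef_zassenhaus_mul => //; rewrite ltn_neqAle wm -uv_size.
exact: size_infiltration.
Qed.

Lemma sum_alpha_shuffles : \sum_(w <- shuffles u v) alpha p n iota w = 0.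
Proof.
have LI := magnus_infiltrative R iota_free.
have [a [g [-> gc aE]]] : exists (a : Z2 p G) (g : G -> 'Z_p), _ :=
  @sum_alpha_cocycle (shuffles u v) (fun w wl => etrans (size_shuffles wl) uv_size).
pose F s := \sum_(w <- shuffles u v) (L s w : R).
(* [F] depends only on the class of its argument. *)
have Frepr s : F (repr (\pi_G s)) = F s.
  have := mem_repr_pi N s; set t := (_ * _)%g => Nt.
  rewrite -[repr _](mulKVg s) -/t; exact: shuffle_sum_zassenhaus.
suff -> : \pi_{ideal_quot (B2 p G)} a = \pi_{ideal_quot (B2 p G)} 0 by rewrite raddf0.
(* The cochain [g] bounds [a]. It is locally constant because [emb (g x) + F (repr x)] and
   [F (repr x)] are, and [emb] is injective. *)
apply/eqP; rewrite -Quotient.idealrBE subr0; apply/asboolP; exists g; split.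
  apply/continuous_discreteP; apply: (locally_constant_inj (@Zp_embed_inj _ j p_pr)).
  have -> : emb \o g = (fun x => (emb (g x) + F (repr x)) - F (repr x)).
    by apply/funext => x; rewrite addrK.
  apply: (locally_constant_op (fun r r1 : R => r - r1)
    (g := fun x : G => F (repr x)) gc); apply: locally_constant_quotient.
  rewrite [X in locally_constant X](_ : _ = F); last first.
    by apply/funext => s; exact: Frepr.
  by apply: locally_constant_sum => w; exact: infil_continuous LI w.
move=> x y; apply: (@Zp_embed_inj _ j p_pr).
rewrite aE -/(F _) -/(F _).
(* Writing [x] and [y] as classes of their representatives turns [F (repr (x * y))] into
   [F (repr x * repr y)], and the two sums cancel. *)
rewrite -[in F (repr (x * y)%g)](reprK x) -[in F (repr _)](reprK y).
rewrite quotient_mulE Frepr subrr addr0 !Zp_embedD // Zp_embedN //; ring.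
Qed.

End Shuffle.
End Alpha.

Local Close Scope quotient_scope.

Theorem theorem9p3 (p n : nat) (d : Order.disp_t) (X : orderType d)
    (S : profiniteGroupType) (iota : X -> S) (u v : seq X) :
  prime p -> (2 <= n)%N -> [set: X] !=set0 -> free_profinite iota ->
  u <> [::] -> v <> [::] -> JJ p n (size u + size v) ->
  \sum_(w \in [set w : seq X | size w = (size u + size v)%N])
      alpha p n iota w *~ shuffle u v w
    = 0 :> H2 p (quotient_group (zassenhaus S p n)).
Proof.
move=> p_pr _ _ iota_free u0 v0 uvJ.
(* [X] may be infinite: the sum is cut down to the finitely many words of [shuffles u v], outside
   which the coefficient is 0. *)
rewrite -(fsbig_widen [set` undup (shuffles u v)]).
- rewrite -fsbig_seq ?undup_uniq //.
  under eq_bigr => w _ do rewrite shuffleE //.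
  rewrite -[RHS](sum_alpha_shuffles p_pr iota_free uvJ erefl u0 v0).
  rewrite -[RHS]big_undup_iterop_count; apply: eq_bigr => w _.
  by rewrite natz -pmulrn.
- by move=> w /=; rewrite mem_undup => /size_shuffles.
- move=> w /= [_ wn]; rewrite shuffleE // (count_memPn _) ?mulr0z //.
  by apply/negP; rewrite -mem_undup.
Qed.
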